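(* Let $\mathcal G$ be a Lie superalgebra over a field of characteristic zero with bracket $[\cdot,\cdot]$, and let $\mathcal G=\mathcal H\oplus\mathcal E$ be a direct sum decomposition of vector spaces in which $\mathcal H$ is a subalgebra (no condition on $\mathcal E$). With $a(p)\in\mathcal S_{\mathcal E}\cap\mathcal S_{1-p}$ defined below for $a\in\mathcal G$ and $p\ge0$, the map $$\mathcal G\to\mathcal S_{\mathcal E},\qquad a\mapsto\sum_{p=0}^\infty a(p)$$ is a Lie superalgebra homomorphism, i.e. it is linear and $[\![\sum_p a(p),\sum_q b(q)]\!]=\sum_r [a,b](r)$ for all $a,b\in\mathcal G$, where $[\![\cdot,\cdot]\!]$ is the bracket on $\mathcal S$ described below.
   Context: Set $\mathcal U_1=\mathcal G$ with its $\mathbb Z_2$-grading. For $p\ge1$ define recursively $\mathcal U_{-p+1}=\mathrm{Hom}(\mathcal U_1,\mathcal U_{-p+2})$, $\mathbb Z_2$-graded by declaring $A$ even (resp. odd) if it preserves (resp. reverses) parity; $|u|$ is the parity of a homogeneous element, and sign formulas are for homogeneous elements extended bilinearly. Elements of $\mathcal U_{1-p}$ are operators of order $p$ (elements of $\mathcal G$ have order $0$), identified for $p\ge1$ with $p$-linear maps $A(x_1,\dots,x_p)=A(x_1)\cdots(x_p)$; $\mathcal U_{1-}=\bigoplus_{p\ge0}\mathcal U_{1-p}$. An operator of order $p\ge2$ is symmetric if $A(\dots,x_i,x_{i+1},\dots)=(-1)^{|x_i||x_{i+1}|}A(\dots,x_{i+1},x_i,\dots)$ for all homogeneous arguments and all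 $i$; operators of order $0$ or $1$ are symmetric; $\mathcal S=\bigoplus_{p\ge0}\mathcal S_{1-p}$ with $\mathcal S_{1-p}$ the symmetric operators of order $p$. Define $\circ$: $A\circ y=A(y)$, $y\circ A=0$ for $A$ of order $\ge1$, $y\in\mathcal U_1$; for $A,B$ of orders $\ge1$, recursively $(A\circ B)(x)=A\circ B(x)+(-1)^{|B||x|}A(x)\circ B$. Define $\bullet$: $A_p\bullet B_q=\frac{p!q!}{(p+q-1)!}A_p\circ B_q$ for orders $p,q\ge1$; $A_p\bullet x=pA_p(x)$, $x\bullet A_p=0$, $x\bullet y=0$ for $x,y\in\mathcal U_1$. The bracket on $\mathcal S$ is $[\![A,B]\!]=A\bullet B-(-1)^{|A||B|}B\bullet A$; it maps $\mathcal S_{1-p}\times\mathcal S_{1-q}$ into operators of order $p+q-1$ (zero if $p=q=0$), so it extends to formal infinite sums $\sum_p X_p$, $X_p\in\mathcal S_{1-p}$, by $[\![\sum_pX_p,\sum_qY_q]\!]=\sum_{r\ge0}\sum_{p+q=r+1}[\![X_p,Y_q]\!]$, and infinite sums in the statement are understood as such formal sums. The bracket of $\mathcal G$ extends to $\mathcal U_{1-}$: on $\mathcal G$ it is the given bracket, and for operators $A,B$ of orders $p,q$ with $p+q\ge1$, $[A,B]$ is the operator of order $p+q$ defined recursively by $[A,B]\bullet x=[A,B\bullet x]+(-1)^{|x||B|}[A\bullet x,B]$ for all $x\in\mathcal G$. $1$ is the identity map of $\mathcal G$ (even, order $1$); $[A,0]=A$, $[A,k]=[[A,k-1],1]$. For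 $x\in\mathcal G$ write $x=x_{\mathcal H}+x_{\mathcal E}$; for an operator $X$ of order $\ge1$, $X_{\mathcal H},X_{\mathcal E}$ are defined recursively by $X_{\mathcal H}\bullet x=(X\bullet x)_{\mathcal H}$, $X_{\mathcal E}\bullet x=(X\bullet x)_{\mathcal E}$ (equivalently $X_{\mathcal E}(x_1,\dots,x_p)=(X(x_1,\dots,x_p))_{\mathcal E}$), and $\mathcal S_{\mathcal E}$ is the span of all $X_{\mathcal E}$ with $X\in\mathcal S$. For $a\in\mathcal G$ define recursively $a(0)=a_{\mathcal E}$ and, for $p\ge1$, $$a(p)=\frac1{p!}([a,p])_{\mathcal E}-\sum_{q+r=p-1}\frac{1}{(r+2)!}([a(q),r+1])_{\mathcal E},$$ the sum over non-negative integers $q,r$.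
   Formalization: The decomposition of G into H and E is assumed compatible with the Z_2-grading (H and E are graded subspaces); for an ungraded complement E the bracket identity can fail, e.g. [e,e]=c, H=<h'>, E=<e,c+h'> with e,h' odd and c even. *)

(* Defs.v *)
From HB Require Import structures.
From mathcomp Require Import all_boot all_order all_algebra.
Set Implicit Arguments. Unset Strict Implicit. Unset Printing Implicit Defensive.
Import GRing.Theory.
Local Open Scope ring_scope.

(* Conventions.
   - Parities are booleans: false = even, true = odd.
   - The Z2-grading of G is given by the linear idempotent [ev] (projection on
     the even part); the odd part of x is x - ev x.
   - [br] is the bracket of G; [pE] is the projection x |-> x_E of the
     decomposition G = H (+) E (H = ker pE, E = im pE).
   - An operator (element of U_{1-}) is modelled as a function on finite lists of
     parity-tagged homogeneous arguments; an operator of order p is evaluated on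
     lists of length p (its values on homogeneous arguments determine it by
     multilinearity; "sign formulas are for homogeneous elements").
     An element y of G = U_1 (order 0) is the constant operator [cst y]. *)

Section LieSuper.
Variables (K : fieldType) (G : lmodType K).
Variable ev : G -> G.
Variable br : G -> G -> G.
Variable pE : G -> G.

Definition proj (b : bool) (x : G) : G := if b then x - ev x else ev x.
Definition homog (b : bool) (x : G) : Prop := proj (~~ b) x = 0.
Definition ssign (b : bool) (x : G) : G := if b then - x else x.

Definition is_lie_superalgebra : Prop :=
  (forall k x y, ev (k *: x + y) = k *: ev x + ev y) /\
      (forall x, ev (ev x) = ev x) /\
      (forall k x y z, br (k *: x + y) z = k *: br x z + br y z) /\
      (forall k x y z, br z (k *: x + y) = k *: br z x + br z y) /\
      (forall i j x y, homog i x -> homog j y -> homog (i (+) j) (br x y)) /\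
      (forall i j x y, homog i x -> homog j y -> br x y = - ssign (i && j) (br y x)) /\
      (forall i j x y z, homog i x -> homog j y ->
          br x (br y z) = br (br x y) z + ssign (i && j) (br y (br x z))).

(* G = H (+) E as (graded) vector spaces with H = ker pE a subalgebra. *)
Definition is_decomposition : Prop :=
  [/\ (forall k x y, pE (k *: x + y) = k *: pE x + pE y),
      (forall x, pE (pE x) = pE x),
      (forall x, pE (ev x) = ev (pE x)) &
      (forall x y, pE x = 0 -> pE y = 0 -> pE (br x y) = 0)].

Definition op := seq (bool * G) -> G.

Fixpoint valid (xs : seq (bool * G)) : Prop :=
  match xs with [::] => True | x :: r => homog x.1 x.2 /\ valid r end.

Definition psum (xs : seq (bool * G)) : bool := foldr (fun x b => x.1 (+) b) false xs.

Definition opPar (s : bool) (B : op) : op := fun xs => proj (s (+) psum xs) (B xs).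
Definition app (A : op) (x : bool * G) : op := fun xs => A (x :: xs).
(* A(y) for an arbitrary y in G (bilinear extension) *)
Definition app_elem (A : op) (y : G) : op :=
  fun xs => A ((false, proj false y) :: xs) + A ((true, proj true y) :: xs).
Definition cst (y : G) : op := fun _ => y.
Definition idop : op := fun xs => if xs is x :: _ then x.2 else 0.
Definition opE (X : op) : op := fun xs => pE (X xs).

(* A o B for A of order p >= 1 and B of order q (result of order p+q-1):
   A o y = A(y);  (A o B)(x) = A o B(x) + (-1)^{|B||x|} A(x) o B,  y o B = 0. *)
Fixpoint compo (p q : nat) (A B : op) (xs : seq (bool * G)) {struct xs} : G :=
  match q with
  | 0 => app_elem A (B [::]) xs
  | q'.+1 =>
    match xs with
    | [::] => 0
    | x :: rest =>
        compo p q' A (app B x) rest +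
        (if (1 < p)%N then
           compo p.-1 q (app A x) (opPar false B) rest
           + ssign x.1 (compo p.-1 q (app A x) (opPar true B) rest)
         else 0)
    end
  end.

Definition bullet (p q : nat) (A B : op) : op :=
  if p is 0 then (fun _ => 0) else
  fun xs => ((p`!)%:R * (q`!)%:R / (((p + q).-1)`!)%:R) *: compo p q A B xs.

(* [[A, B]] = A bullet B - (-1)^{|A||B|} B bullet A, extended bilinearly *)
Definition dbr (p q : nat) (A B : op) : op := fun xs =>
  bullet p q A B xs
  - \sum_(s : bool) \sum_(t : bool)
        ssign (s && t) (bullet q p (opPar t B) (opPar s A) xs).

(* extension [A, B] of the bracket to U_{1-}: on G it is br, and for p+q >= 1
   [A,B] bullet x = [A, B bullet x] + (-1)^{|x||B|} [A bullet x, B]. *)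
Fixpoint obr (p q : nat) (A B : op) (xs : seq (bool * G)) {struct xs} : G :=
  if p + q is 0 then br (A [::]) (B [::]) else
  match xs with
  | [::] => 0
  | x :: rest =>
      ((p + q)%:R)^-1 *:
        ((if q is q'.+1 then q%:R *: obr p q' A (app B x) rest else 0)
         + (if p is p'.+1 then
              p%:R *: (obr p' q (app A x) (opPar false B) rest
                       + ssign x.1 (obr p' q (app A x) (opPar true B) rest))
            else 0))
  end.

Fixpoint iterbr (m : nat) (A : op) (k : nat) : op :=
  if k is k'.+1 then obr (m + k') 1 (iterbr m A k') idop else A.

(* a(p) = 1/p! ([a,p])_E - sum_{q+r=p-1} 1/(r+2)! ([a(q), r+1])_E,
   computed from the list l = [a(0); ...; a(p-1)] *)
Definition anext (a : G) (l : seq op) (p : nat) : op := fun xs =>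
  ((p`!)%:R)^-1 *: pE (iterbr 0 (cst a) p xs)
  - \sum_(q < p) ((((p - q).+1)`!)%:R)^-1 *:
        pE (iterbr q (nth (cst 0) l q) (p - q) xs).

Fixpoint alist (a : G) (n : nat) : seq op :=
  if n is n'.+1 then rcons (alist a n') (anext a (alist a n') n)
  else [:: opE (cst a)].

Definition acomp (a : G) (p : nat) : op := nth (cst 0) (alist a p) p.

Definition swap_at (i : nat) (xs : seq (bool * G)) : seq (bool * G) :=
  take i xs ++ (nth (false, 0) xs i.+1 :: nth (false, 0) xs i :: drop i.+2 xs).

Definition op_symmetric (p : nat) (A : op) : Prop :=
  forall xs, valid xs -> size xs = p -> forall i, (i.+1 < p)%N ->
    A (swap_at i xs) =
    ssign ((nth (false, 0) xs i).1 && (nth (false, 0) xs i.+1).1) (A xs).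

End LieSuper.

(* Main.v *)
Require Import Defs.
From HB Require Import structures.
From mathcomp Require Import all_boot all_order all_algebra.
Set Implicit Arguments. Unset Strict Implicit. Unset Printing Implicit Defensive.
Import GRing.Theory.
Local Open Scope ring_scope.

(* Symmetric operators are formal power series [G -> G] of vector fields: [[A, B]] is the commutator
   of vector fields and [A, B] the pointwise bracket.  Writing V_a for the sum of the a(p), the
   recursion for a(p) says that V_a takes values in E and that
     W_a(x) = exp(- ad x) a - theta_x(V_a(x)),  theta_x = (1 - exp(- ad x)) / ad x,
   takes values in H; these two conditions determine V_a (it is the action of a on exp(x) H).
   The Maurer-Cartan equation for theta gives
     D_{V_b} W_a - D_{V_a} W_b = exp(- ad x) [a, b] - [W_a, W_b] - theta_x([[V_a, V_b]]),
   up to super signs.  As H is a subalgebra, [[V_a, V_b]] satisfies the conditions that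
   characterize V_{[a, b]}.

   A series is handled through its Taylor coefficients at 0: its value on a list of length n is
   n! times its component of order n, so that [app f x] is the derivative of [f] along [x], and
   all products obey unweighted Leibniz rules. *)

Ltac move_to_end t :=
  repeat match goal with |- context [?s + t + ?v] => rewrite (addrAC s t v) end.
(** Proves identities in an abelian group: everything is moved to one side, and each subtracted term
    is carried to the end next to its positive copy, where the two cancel. The leading 0 ensures
    that every summand has a left neighbour. *)
Ltac zmod_cancel :=
  apply/eqP; rewrite -subr_eq0; apply/eqP;
  rewrite -[LHS]add0r; repeat (rewrite ?opprD ?opprK ?addrA);
  repeat match goal with
  | |- context [@GRing.opp ?V ?u] =>
      move_to_end u; move_to_end (@GRing.opp V u); rewrite addrK
  end; rewrite ?addr0; reflexivity.

Section TaylorOperators.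
Variables (K : fieldType) (G : lmodType K).
Variables (ev : G -> G) (br : G -> G -> G) (pE : G -> G).
Hypothesis charK : [pchar K] =i pred0.
Hypothesis hG : is_lie_superalgebra ev br.
Hypothesis hD : is_decomposition ev br pE.

Local Notation op := (op G).
Local Notation homog := (homog ev).
Local Notation valid := (valid ev).
Local Notation proj := (proj ev).

(** * Signs, parities and the structure maps of the superalgebra *)

Lemma ssignE b (x : G) : ssign b x = (-1) ^+ b *: x.
Proof. by case: b; rewrite /= ?expr1 ?scaleN1r ?scale1r. Qed.

Lemma ssign0 b : ssign b (0 : G) = 0.
Proof. by rewrite ssignE scaler0. Qed.

Lemma ssignD b (x y : G) : ssign b (x + y) = ssign b x + ssign b y.
Proof. by rewrite !ssignE scalerDr. Qed.

Lemma ssignZ b k (x : G) : ssign b (k *: x) = k *: ssign b x.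
Proof. by rewrite !ssignE !scalerA mulrC. Qed.

Lemma ssign_ssign b c (x : G) : ssign b (ssign c x) = ssign (b (+) c) x.
Proof. by case: b; case: c => //=; rewrite opprK. Qed.

Lemma evL k x y : ev (k *: x + y) = k *: ev x + ev y.
Proof. by case: hG. Qed.

Lemma ev_id x : ev (ev x) = ev x.
Proof. by case: hG => _ []. Qed.

Lemma brDl x y z : br (x + y) z = br x z + br y z.
Proof. by case: hG => _ [_ [h _]]; rewrite -[x]scale1r h !scale1r. Qed.

Lemma br0l z : br 0 z = 0.
Proof. by apply: (@addrI _ (br 0 z)); rewrite -brDl !addr0. Qed.

Lemma brZl k x z : br (k *: x) z = k *: br x z.
Proof. by case: hG => _ [_ [h _]]; rewrite -[k *: x]addr0 h br0l addr0. Qed.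

Lemma brDr x y z : br z (x + y) = br z x + br z y.
Proof. by case: hG => _ [_ [_ [h _]]]; rewrite -[x]scale1r h !scale1r. Qed.

Lemma br0r z : br z 0 = 0.
Proof. by apply: (@addrI _ (br z 0)); rewrite -brDr !addr0. Qed.

Lemma brZr k x z : br z (k *: x) = k *: br z x.
Proof. by case: hG => _ [_ [_ [h _]]]; rewrite -[k *: x]addr0 h br0r addr0. Qed.

Lemma homog_br i j x y : homog i x -> homog j y -> homog (i (+) j) (br x y).
Proof. by case: hG => _ [_ [_ [_ [h _]]]]; exact: h. Qed.

Lemma br_antisym i j x y : homog i x -> homog j y -> br x y = - ssign (i && j) (br y x).
Proof. by case: hG => _ [_ [_ [_ [_ [h _]]]]]; exact: h. Qed.

(** The right-handed Jacobi identity: bracketing with [z] on the right is a superderivation. This is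
    the form that suits [tad]. *)
Lemma br_jacobi i j k x y z : homog i x -> homog j y -> homog k z ->
  br (br x y) z = br x (br y z) + ssign (j && k) (br (br x z) y).
Proof.
move=> hx hy hz; have [_ [_ [_ [_ [_ [_ h]]]]]] := hG.
rewrite (h _ _ _ _ z hx hy) (br_antisym hy (homog_br hx hz)).
by case: i hx j hy k hz => + [] + [] /=; rewrite ?opprK ?addrK ?subrK.
Qed.

Lemma projL b k x y : proj b (k *: x + y) = k *: proj b x + proj b y.
Proof.
by case: b; rewrite /Defs.proj evL // opprD scalerBr addrACA.
Qed.

Lemma proj0 b : proj b 0 = 0.
Proof.
by move: (projL b 1 0 0); rewrite !scale1r addr0 -[LHS]addr0 => /addrI.
Qed.

Lemma projZ b k x : proj b (k *: x) = k *: proj b x.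
Proof. by rewrite -[k *: x]addr0 projL proj0 addr0. Qed.

Lemma projD x : proj false x + proj true x = x.
Proof. by rewrite /Defs.proj addrC subrK. Qed.

Lemma proj_proj b c x : proj b (proj c x) = if b == c then proj b x else 0.
Proof.
have ev0 : ev 0 = 0 := proj0 false.
have evB : ev (x - ev x) = 0.
  by rewrite addrC -scaleN1r evL ev_id scaleN1r addNr.
by case: b; case: c; rewrite /Defs.proj /= ?ev_id ?evB ?subr0 ?subrr.
Qed.

Lemma homog_proj b x : homog b (proj b x).
Proof. by rewrite /Defs.homog proj_proj; case: b. Qed.

Lemma proj_homog b c x : homog b x -> proj c x = if c == b then x else 0.
Proof.
rewrite /Defs.homog; case: b; case: c => //; rewrite /Defs.proj /= => h.
  by rewrite h subr0.
by apply/eqP; rewrite eq_sym -subr_eq0 h.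
Qed.

Lemma homog0 b : homog b 0. Proof. exact: proj0. Qed.

Lemma homogL b k x y : homog b x -> homog b y -> homog b (k *: x + y).
Proof. by rewrite /Defs.homog projL => -> ->; rewrite scaler0 addr0. Qed.

Lemma homogZ b k x : homog b x -> homog b (k *: x).
Proof. by rewrite /Defs.homog projZ => ->; rewrite scaler0. Qed.

Lemma homogD b x y : homog b x -> homog b y -> homog b (x + y).
Proof. by rewrite -{2}[x]scale1r; exact: homogL. Qed.

Lemma homog_ssign b c x : homog b x -> homog b (ssign c x).
Proof. by rewrite ssignE; exact: homogZ. Qed.

Lemma pEL k x y : pE (k *: x + y) = k *: pE x + pE y.
Proof. by case: hD. Qed.

Lemma pE_id x : pE (pE x) = pE x. Proof. by case: hD. Qed.

Lemma pE_br x y : pE x = 0 -> pE y = 0 -> pE (br x y) = 0.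
Proof. by case: hD => _ _ _; exact. Qed.

Lemma pED x y : pE (x + y) = pE x + pE y.
Proof. by rewrite -[x]scale1r pEL !scale1r. Qed.

Lemma pE0 : pE 0 = 0.
Proof. by apply: (@addrI _ (pE 0)); rewrite -pED !addr0. Qed.

Lemma pEZ k x : pE (k *: x) = k *: pE x.
Proof. by rewrite -[k *: x]addr0 pEL pE0 addr0. Qed.

Lemma pEB x y : pE (x - y) = pE x - pE y.
Proof. by rewrite pED -scaleN1r pEZ scaleN1r. Qed.

Lemma pE_ssign b x : pE (ssign b x) = ssign b (pE x).
Proof. by rewrite !ssignE pEZ. Qed.

Lemma pE_sum (I : Type) (r : seq I) (P : pred I) (F : I -> G) :
  pE (\sum_(i <- r | P i) F i) = \sum_(i <- r | P i) pE (F i).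
Proof. exact: (big_morph _ pED pE0). Qed.

Lemma homog_pE b x : homog b x -> homog b (pE x).
Proof.
have [_ _ h _] := hD; rewrite /Defs.homog => h0; rewrite -[RHS]pE0 -h0.
by case: b {h0}; rewrite /Defs.proj /= ?pEB h.
Qed.

(** * Taylor series: pointwise bracket, directional derivative, powers of [ad x] *)

(* In [tbr s f g] and [tder s f g], [s] is the parity of [g]. *)
Fixpoint tbr (s : bool) (f g : op) (xs : seq (bool * G)) : G :=
  if xs is x :: r then
    tbr (s (+) x.1) f (app g x) r + ssign (x.1 && s) (tbr s (app f x) g r)
  else br (f [::]) (g [::]).

Fixpoint tder (s : bool) (f g : op) (xs : seq (bool * G)) : G :=
  if xs is x :: r then
    tder (s (+) x.1) f (app g x) r + ssign (x.1 && s) (tder s (app f x) g r)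
  else f [:: (s, g [::])].

(** In contrast to [cst] and [idop], the series [tcst] and [tid] vanish on lists of the wrong
    length: a series carries all orders at once, and its other components must be zero. *)
Definition tcst (y : G) : op := fun xs => if xs is [::] then y else 0.
Definition tid : op := fun xs => if xs is [:: x] then x.2 else 0.
(** The bracket with the generic point on the right, that is [- ad x]. *)
Definition tad (f : op) : op := tbr false f tid.
(* The divided power [tad^k / k!]. *)
Fixpoint tpow (k : nat) (f : op) : op :=
  if k is k'.+1 then fun xs => (k%:R)^-1 *: tad (tpow k' f) xs else f.

Definition homop (s : bool) (f : op) : Prop :=
  forall xs, valid xs -> homog (s (+) psum xs) (f xs).

Lemma homop_app s f x : homop s f -> homog x.1 x.2 -> homop (s (+) x.1) (app f x).
Proof. by move=> hf hx xs hxs; rewrite -addbA; exact: (hf (x :: xs)). Qed.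

Lemma homop_tbr s t f g : homop s f -> homop t g -> homop (s (+) t) (tbr t f g).
Proof.
move=> + + xs; elim: xs s t f g => [|x r IH] s t f g hf hg /=.
  by move=> _; have := homog_br (hf [::] I) (hg [::] I); rewrite !addbF.
case=> hx hr; apply: homogD.
  have := IH _ _ _ _ hf (homop_app hg hx) hr.
  by rewrite -!addbA.
apply: homog_ssign; have := IH _ _ _ _ (homop_app hf hx) hg hr.
by rewrite -!addbA [x.1 (+) _]addbCA.
Qed.

(** * Locality and linearity of the two products *)

Lemma eq_tbr s f f' g g' xs : valid xs ->
  (forall ys, valid ys -> (size ys <= size xs)%N -> f ys = f' ys) ->
  (forall ys, valid ys -> (size ys <= size xs)%N -> g ys = g' ys) ->
  tbr s f g xs = tbr s f' g' xs.
Proof.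
elim: xs s f f' g g' => [|x r IH] s f f' g g' /=.
  by move=> _ hf hg; rewrite hf ?hg.
case=> hx hr hf hg; rewrite (IH _ f f' (app g x) (app g' x)) //; last first.
- by move=> ys hy hs; apply: hg.
- by move=> ys hy hs; apply: hf => //; exact: leqW.
rewrite (IH _ (app f x) (app f' x) g g') //.
- by move=> ys hy hs; apply: hf.
- by move=> ys hy hs; apply: hg => //; exact: leqW.
Qed.

(** The value of [g] is inserted as an argument of [f]; homogeneity of [g] keeps the longer list
    valid, and [f] is read one degree higher. *)
Lemma eq_tder s f f' g g' xs : valid xs -> homop s g ->
  (forall ys, valid ys -> (size ys <= (size xs).+1)%N -> f ys = f' ys) ->
  (forall ys, valid ys -> (size ys <= size xs)%N -> g ys = g' ys) ->
  tder s f g xs = tder s f' g' xs.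
Proof.
elim: xs s f f' g g' => [|x r IH] s f f' g g' /=.
  move=> _ hh hf hg; rewrite hf ?hg //=; split=> //.
  by have := hh [::] I; rewrite addbF -hg.
case=> hx hr hh hf hg.
rewrite (IH _ f f' (app g x) (app g' x)) //; last first.
- by move=> ys hy hs; apply: hg.
- by move=> ys hy hs; apply: hf => //; exact: leqW.
- exact: homop_app.
rewrite (IH _ (app f x) (app f' x) g g') //.
- by move=> ys hy hs; apply: hf.
- by move=> ys hy hs; apply: hg => //; exact: leqW.
Qed.

Lemma tbrLl s k f f' g xs :
  tbr s (fun ys => k *: f ys + f' ys) g xs = k *: tbr s f g xs + tbr s f' g xs.
Proof.
elim: xs s f f' g => [|x r IH] s f f' g /=; first by rewrite brDl brZl.
by rewrite IH (IH _ (app f x) (app f' x)) ssignD ssignZ scalerDr addrACA.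
Qed.

Lemma tbrLr s k f g g' xs :
  tbr s f (fun ys => k *: g ys + g' ys) xs = k *: tbr s f g xs + tbr s f g' xs.
Proof.
elim: xs s f g g' => [|x r IH] s f g g' /=; first by rewrite brDr brZr.
by rewrite IH (IH _ _ (app g x) (app g' x)) ssignD ssignZ scalerDr addrACA.
Qed.

Lemma tderL s k f f' g xs :
  tder s (fun ys => k *: f ys + f' ys) g xs = k *: tder s f g xs + tder s f' g xs.
Proof.
elim: xs s f f' g => [|x r IH] s f f' g //=.
by rewrite IH (IH _ (app f x) (app f' x)) ssignD ssignZ scalerDr addrACA.
Qed.

Lemma tbr_f0l s g xs : tbr s (fun=> 0) g xs = 0.
Proof.
by elim: xs s g => [|x r IH] s g /=; rewrite ?br0l // !IH ssign0 addr0.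
Qed.

Lemma tbr_f0r s f xs : tbr s f (fun=> 0) xs = 0.
Proof.
by elim: xs s f => [|x r IH] s f /=; rewrite ?br0r // !IH ssign0 addr0.
Qed.

Lemma tder_f0 s g xs : tder s (fun=> 0) g xs = 0.
Proof. by elim: xs s g => [|x r IH] s g //=; rewrite !IH ssign0 addr0. Qed.

Lemma eq1_tbr s f f' g g' : f =1 f' -> g =1 g' -> tbr s f g =1 tbr s f' g'.
Proof.
move=> hf hg xs; elim: xs s f f' g g' hf hg => [|x r IH] s f f' g g' hf hg /=.
  by rewrite hf hg.
by rewrite (IH _ f f' _ (app g' x)) // 1?(IH _ (app f x) (app f' x) g g') // => ys;
   rewrite /app.
Qed.

Lemma eq1_tder s f f' g g' : f =1 f' -> g =1 g' -> tder s f g =1 tder s f' g'.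
Proof.
move=> hf hg xs; elim: xs s f f' g g' hf hg => [|x r IH] s f f' g g' hf hg /=.
  by rewrite hf hg.
by rewrite (IH _ f f' _ (app g' x)) // 1?(IH _ (app f x) (app f' x) g g') // => ys;
   rewrite /app.
Qed.

Lemma tbrZl s k f g xs : tbr s (fun ys => k *: f ys) g xs = k *: tbr s f g xs.
Proof.
rewrite -[RHS]addr0 -[X in _ = _ + X](tbr_f0l s g xs) -tbrLl.
by apply: eq1_tbr => // ys; rewrite addr0.
Qed.

Lemma tbrZr s k f g xs : tbr s f (fun ys => k *: g ys) xs = k *: tbr s f g xs.
Proof.
rewrite -[RHS]addr0 -[X in _ = _ + X](tbr_f0r s f xs) -tbrLr.
by apply: eq1_tbr => // ys; rewrite addr0.
Qed.

Lemma tderZ s k f g xs : tder s (fun ys => k *: f ys) g xs = k *: tder s f g xs.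
Proof.
rewrite -[RHS]addr0 -[X in _ = _ + X](tder_f0 s g xs) -tderL.
by apply: eq1_tder => // ys; rewrite addr0.
Qed.

Lemma tbrDl s f f' g xs :
  tbr s (fun ys => f ys + f' ys) g xs = tbr s f g xs + tbr s f' g xs.
Proof.
by rewrite -[tbr s f g xs]scale1r -tbrLl; apply: eq1_tbr => // ys; rewrite scale1r.
Qed.

Lemma tbrDr s f g g' xs :
  tbr s f (fun ys => g ys + g' ys) xs = tbr s f g xs + tbr s f g' xs.
Proof.
by rewrite -[tbr s f g xs]scale1r -tbrLr; apply: eq1_tbr => // ys; rewrite scale1r.
Qed.

Lemma tderD s f f' g xs :
  tder s (fun ys => f ys + f' ys) g xs = tder s f g xs + tder s f' g xs.
Proof.
by rewrite -[tder s f g xs]scale1r -tderL; apply: eq1_tder => // ys; rewrite scale1r.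
Qed.

Lemma tbr_ssignl s b f g xs :
  tbr s (fun ys => ssign b (f ys)) g xs = ssign b (tbr s f g xs).
Proof.
by rewrite ssignE -tbrZl; apply: eq1_tbr => // ys; rewrite ssignE.
Qed.

Lemma tbr_ssignr s b f g xs :
  tbr s f (fun ys => ssign b (g ys)) xs = ssign b (tbr s f g xs).
Proof.
by rewrite ssignE -tbrZr; apply: eq1_tbr => // ys; rewrite ssignE.
Qed.

Lemma tder_ssign s b f g xs :
  tder s (fun ys => ssign b (f ys)) g xs = ssign b (tder s f g xs).
Proof.
by rewrite ssignE -tderZ; apply: eq1_tder => // ys; rewrite ssignE.
Qed.

Lemma tbr_suml s N (F : 'I_N -> op) g xs :
  tbr s (fun ys => \sum_(i < N) F i ys) g xs = \sum_(i < N) tbr s (F i) g xs.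
Proof.
elim: N F => [|N IH] F.
  by rewrite big_ord0 -[RHS](tbr_f0l s g xs); apply: eq1_tbr => // ys; rewrite big_ord0.
rewrite big_ord_recr /= -IH -tbrDl.
by apply: eq1_tbr => // ys; rewrite big_ord_recr.
Qed.

Lemma tbr_sumr s N f (F : 'I_N -> op) xs :
  tbr s f (fun ys => \sum_(i < N) F i ys) xs = \sum_(i < N) tbr s f (F i) xs.
Proof.
elim: N F => [|N IH] F.
  by rewrite big_ord0 -[RHS](tbr_f0r s f xs); apply: eq1_tbr => // ys; rewrite big_ord0.
rewrite big_ord_recr /= -IH -tbrDr.
by apply: eq1_tbr => // ys; rewrite big_ord_recr.
Qed.

Lemma tder_sum s N (F : 'I_N -> op) g xs :
  tder s (fun ys => \sum_(i < N) F i ys) g xs = \sum_(i < N) tder s (F i) g xs.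
Proof.
elim: N F => [|N IH] F.
  by rewrite big_ord0 -[RHS](tder_f0 s g xs); apply: eq1_tder => // ys; rewrite big_ord0.
rewrite big_ord_recr /= -IH -tderD.
by apply: eq1_tder => // ys; rewrite big_ord_recr.
Qed.

(** * Super Lie identities and derivation rules for series *)

(** This and the next four lemmas push a derivative through a product nested in another one: [app]
    of a product is by computation its Leibniz sum, over which the outer product distributes. *)
Lemma tbr_appl s t u v x g xs :
  tbr s (app (tbr t u v) x) g xs =
  tbr s (tbr (t (+) x.1) u (app v x)) g xs
  + ssign (x.1 && t) (tbr s (tbr t (app u x) v) g xs).
Proof. by rewrite -tbr_ssignl -tbrDl. Qed.

Lemma tbr_appr s t u v x f xs :
  tbr s f (app (tbr t u v) x) xs =
  tbr s f (tbr (t (+) x.1) u (app v x)) xs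
  + ssign (x.1 && t) (tbr s f (tbr t (app u x) v) xs).
Proof. by rewrite -tbr_ssignr -tbrDr. Qed.

Lemma tder_app_tbr s t u v x g xs :
  tder s (app (tbr t u v) x) g xs =
  tder s (tbr (t (+) x.1) u (app v x)) g xs
  + ssign (x.1 && t) (tder s (tbr t (app u x) v) g xs).
Proof. by rewrite -tder_ssign -tderD. Qed.

Lemma tbr_app_derl s t u v x g xs :
  tbr s (app (tder t u v) x) g xs =
  tbr s (tder (t (+) x.1) u (app v x)) g xs
  + ssign (x.1 && t) (tbr s (tder t (app u x) v) g xs).
Proof. by rewrite -tbr_ssignl -tbrDl. Qed.

Lemma tbr_app_derr s t u v x f xs :
  tbr s f (app (tder t u v) x) xs =
  tbr s f (tder (t (+) x.1) u (app v x)) xs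
  + ssign (x.1 && t) (tbr s f (tder t (app u x) v) xs).
Proof. by rewrite -tbr_ssignr -tbrDr. Qed.

(** Antisymmetry and Jacobi pass from [br] to series by induction on the arguments: one derivative
    turns the claim into the same claim for derived series, and only a comparison of signs is
    left. *)
Lemma tbr_antisym a b u v xs : homop a u -> homop b v -> valid xs ->
  tbr b u v xs = - ssign (a && b) (tbr a v u xs).
Proof.
elim: xs a b u v => [|x r IH] a b u v hu hv /=.
  by move=> _; apply: br_antisym; [have := hu [::] I | have := hv [::] I]; rewrite addbF.
case=> hx hr; rewrite (IH _ _ _ _ hu (homop_app hv hx) hr).
rewrite (IH _ _ _ _ (homop_app hu hx) hv hr) addrC.
by case: (x.1) a b {hu hv} => [] [] [] /=; rewrite ?opprD ?opprK //; zmod_cancel.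
Qed.

Lemma tbr_jacobi a b c u v w xs : homop a u -> homop b v -> homop c w -> valid xs ->
  tbr c (tbr b u v) w xs =
  tbr (b (+) c) u (tbr c v w) xs + ssign (b && c) (tbr b (tbr c u w) v xs).
Proof.
elim: xs a b c u v w => [|x r IH] a b c u v w hu hv hw /=.
  move=> _; apply: br_jacobi.
  - exact: (hu [::] I).
  - by have := hv [::] I; rewrite addbF.
  - by have := hw [::] I; rewrite addbF.
case=> hx hr; rewrite !tbr_appl tbr_appr.
rewrite (IH _ _ _ _ _ _ hu hv (homop_app hw hx) hr).
rewrite (IH _ _ _ _ _ _ hu (homop_app hv hx) hw hr).
rewrite (IH _ _ _ _ _ _ (homop_app hu hx) hv hw hr).
by case: (x.1) b c {hv hw} => [] [] [] /=; zmod_cancel.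
Qed.

(** Differentiation is a superderivation of the pointwise bracket. The direction [v] stands on the
    right, so the sign appears when it passes [g]. *)
Lemma tder_tbr s c f g v xs :
  tder s (tbr c f g) v xs =
  tbr (c (+) s) f (tder s g v) xs + ssign (c && s) (tbr c (tder s f v) g xs).
Proof.
elim: xs s c f g v => [|x r IH] s c f g v /=; first by rewrite andbC.
rewrite !tder_app_tbr tbr_app_derr tbr_app_derl !IH.
by case: (x.1) s c => [] [] [] /=; zmod_cancel.
Qed.

Lemma tder_tcst s y v xs : tder s (tcst y) v xs = 0.
Proof.
by elim: xs s v => [|x r IH] s v //=; rewrite IH tder_f0 ssign0 addr0.
Qed.

Lemma tder_tid s v xs : tder s tid v xs = v xs.
Proof.
elim: xs s v => [|x r IH] s v //=; rewrite IH.
by rewrite (tder_tcst s x.2) ssign0 addr0.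
Qed.

(** [tad] involves the point through [tid], whose derivative along [v] is [v]; hence the extra
    bracket. *)
Lemma tder_tad s f v xs : tder s (tad f) v xs = tbr s f v xs + tad (tder s f v) xs.
Proof.
rewrite /tad tder_tbr /=; congr (_ + _).
by apply: eq1_tbr => // ys; exact: tder_tid.
Qed.

Lemma homop_tid : homop false tid.
Proof.
case=> [|x [|y r]] /= h; [exact: homog0 | | exact: homog0].
by rewrite addbF; case: h.
Qed.

Lemma homop_tad s f : homop s f -> homop s (tad f).
Proof. by move=> hf; rewrite -[s]addbF; exact: homop_tbr homop_tid. Qed.

Lemma homop_tpow s k f : homop s f -> homop s (tpow k f).
Proof.
by move=> hf; elim: k => [|k IH] //= xs hxs; apply: homogZ; exact: homop_tad.
Qed.

Lemma tad_tbr a s u v xs : homop a u -> homop s v -> valid xs ->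
  tad (tbr s u v) xs = tbr s u (tad v) xs + tbr s (tad u) v xs.
Proof.
move=> hu hv hxs; rewrite /tad (tbr_jacobi hu hv homop_tid hxs).
by rewrite addbF andbF.
Qed.

(** * Divided powers of [tad]: orders of vanishing and Leibniz rules *)

Lemma natS_neq0 n : (n.+1%:R : K) != 0.
Proof. by rewrite ((pcharf0P K).1 charK). Qed.

Lemma fact_neq0 n : (n`!%:R : K) != 0.
Proof. by rewrite ((pcharf0P K).1 charK) -lt0n fact_gt0. Qed.

(** As [tcst] is supported on the empty list, all arguments go to [f]. *)
Lemma eq_tbr_tcst s f f' y xs : valid xs ->
  (forall ys, valid ys -> size ys = size xs -> f ys = f' ys) ->
  tbr s f (tcst y) xs = tbr s f' (tcst y) xs.
Proof.
elim: xs s f f' => [|x r IH] s f f' /=; first by move=> _ ->.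
case=> hx hr hf; rewrite !tbr_f0r; congr (_ + ssign _ _).
by apply: IH => // ys hy hs; apply: hf; rewrite /= ?hs.
Qed.

Lemma eq_tad f f' xs : valid xs ->
  (forall ys, valid ys -> (size ys).+1 = size xs -> f ys = f' ys) ->
  tad f xs = tad f' xs.
Proof.
elim: xs f f' => [|x r IH] f f'; first by rewrite /tad /= !br0r.
rewrite /tad /= andbF => -[hx hr] hf; congr (_ + _).
  by apply: (eq_tbr_tcst _ x.2) => // ys hy hs; apply: hf; rewrite ?hs.
by apply: IH => // ys hy hs; apply: hf; rewrite /= ?hs.
Qed.

Lemma eq_tpow k f f' xs : valid xs ->
  (forall ys, valid ys -> (size ys + k)%N = size xs -> f ys = f' ys) ->
  tpow k f xs = tpow k f' xs.
Proof.
elim: k xs => [|k IH] xs hxs hf /=; first by apply: hf; rewrite ?addn0.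
congr (_ *: _); apply: eq_tad => // ys hy hs; apply: IH => // zs hz hsz.
by apply: hf => //; rewrite addnS hsz.
Qed.

Lemma tpow_f0 k xs : tpow k (fun=> 0) xs = 0.
Proof.
elim: k xs => [|k IH] xs //=.
by rewrite /tad (eq1_tbr _ IH (frefl _)) tbr_f0l scaler0.
Qed.

Lemma eq1_tpow k f f' : f =1 f' -> tpow k f =1 tpow k f'.
Proof.
by move=> h; elim: k => [|k IH] xs //=; rewrite /tad (eq1_tbr _ IH (frefl _)).
Qed.

Lemma tpowL k c f f' xs :
  tpow k (fun ys => c *: f ys + f' ys) xs = c *: tpow k f xs + tpow k f' xs.
Proof.
elim: k xs => [|k IH] xs //=.
rewrite /tad (eq1_tbr _ IH (frefl _)) tbrLl scalerDr !scalerA.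
by rewrite [_ * c]mulrC.
Qed.

(** Each factor of [tad] consumes one argument. *)
Lemma tpow_small k f xs : valid xs -> (size xs < k)%N -> tpow k f xs = 0.
Proof.
move=> hxs hk; rewrite -[RHS](tpow_f0 k xs); apply: eq_tpow => // ys _ h.
by move: hk; rewrite -h ltnNge leq_addl.
Qed.

(** Orders of vanishing at 0 add up in a product; this justifies cutting off the infinite series
    below. *)
Lemma tbr_small m n s f g xs : valid xs ->
  (forall ys, valid ys -> (size ys < m)%N -> f ys = 0) ->
  (forall ys, valid ys -> (size ys < n)%N -> g ys = 0) ->
  (size xs < m + n)%N -> tbr s f g xs = 0.
Proof.
elim: xs m n s f g => [|x r IH] m n s f g /=.
  case: m => [|m] _ hf hg; first by rewrite add0n => h; rewrite hg ?br0r.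
  by rewrite hf ?br0l.
case=> hx hr hf hg hs; rewrite (IH m n.-1) //.
- rewrite (IH m.-1 n) // ?ssign0 ?addr0 //.
    by move=> ys hy hsy; apply: hf => //=; case: m hsy {hs}.
  by case: m hs {hf} => [|m] //; rewrite !add0n => /ltnW.
- by move=> ys hy hsy; apply: hg => //=; case: n hsy {hs}.
- by case: n hs {hg} => [|n]; rewrite ?addn0 ?addnS // => /ltnW.
Qed.

Lemma tbr_tpow_small m n s f g xs : valid xs -> (size xs < m + n)%N ->
  tbr s (tpow m f) (tpow n g) xs = 0.
Proof. by move=> hxs; apply: tbr_small => // ys; exact: tpow_small. Qed.

Lemma tad_tpow k f xs : tad (tpow k f) xs = k.+1%:R *: tpow k.+1 f xs.
Proof. by rewrite /= scalerA mulfV ?natS_neq0 ?scale1r. Qed.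

Lemma tbr_tad_tpowl s k f g xs :
  tbr s (tad (tpow k f)) g xs = k.+1%:R *: tbr s (tpow k.+1 f) g xs.
Proof. by rewrite -tbrZl; apply: eq1_tbr => // ys; rewrite tad_tpow. Qed.

Lemma tbr_tad_tpowr s k f g xs :
  tbr s f (tad (tpow k g)) xs = k.+1%:R *: tbr s f (tpow k.+1 g) xs.
Proof. by rewrite -tbrZr; apply: eq1_tbr => // ys; rewrite tad_tpow. Qed.

(** Splits k + 1 as (k + 1 - m) + m. This is the induction step of the Leibniz rule [tpow_tbr],
    which for divided powers has no binomial coefficients. *)
Lemma sum_weights k (h : nat -> G) :
  k.+1%:R *: \sum_(m < k.+2) h m =
  \sum_(m < k.+1) ((k - m).+1%:R *: h m + m.+1%:R *: h m.+1).
Proof.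
rewrite big_split /= scaler_sumr.
have -> : \sum_(m < k.+1) m.+1%:R *: h m.+1 = \sum_(m < k.+2) m%:R *: h m.
  by rewrite [RHS]big_ord_recl /= scale0r add0r.
have -> : \sum_(m < k.+1) (k - m).+1%:R *: h m = \sum_(m < k.+2) (k.+1 - m)%:R *: h m.
  rewrite [RHS]big_ord_recr /= subnn scale0r addr0.
  by apply: eq_bigr => m _; rewrite subSn // -ltnS.
rewrite -big_split; apply: eq_bigr => m _ /=.
by rewrite -scalerDl -natrD subnK // -ltnS.
Qed.

Lemma tpow_tbr a s k u v xs : homop a u -> homop s v -> valid xs ->
  tpow k (tbr s u v) xs = \sum_(m < k.+1) tbr s (tpow m u) (tpow (k - m) v) xs.
Proof.
move=> hu hv; elim: k xs => [|k IH] xs hxs; first by rewrite big_ord1.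
apply: (scalerI (natS_neq0 k)); rewrite -tad_tpow.
rewrite (sum_weights k (fun m => tbr s (tpow m u) (tpow (k.+1 - m) v) xs)).
rewrite (eq_tad hxs (fun ys hy _ => IH ys hy)) /tad tbr_suml.
apply: eq_bigr => m _.
rewrite [LHS](tad_tbr (homop_tpow _ hu) (homop_tpow _ hv) hxs).
by rewrite tbr_tad_tpowl tbr_tad_tpowr subSn // -ltnS.
Qed.

(** Splits (k + 1)/(k + 1 - m) as 1 + m/(k + 1 - m). In [tder_tpow] the first part collects the new
    bracket and the terms where [tad] falls on [v], the second those where it falls on [f]. *)
Lemma sum_weights_inv k (h : nat -> G) :
  k.+1%:R *: \sum_(m < k.+1) ((k.+1 - m)%:R^-1 : K) *: h m =
  \sum_(m < k.+1) h m + \sum_(m < k) ((k - m)%:R^-1 * m.+1%:R) *: h m.+1.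
Proof.
rewrite scaler_sumr.
have -> : \sum_(m < k) ((k - m)%:R^-1 * m.+1%:R : K) *: h m.+1 =
          \sum_(m < k.+1) ((k.+1 - m)%:R^-1 * m%:R) *: h m.
  rewrite [RHS]big_ord_recl /= mulr0 scale0r add0r.
  by apply: eq_bigr => m _; rewrite subSS.
rewrite -big_split; apply: eq_bigr => m _ /=.
have lem : (m <= k.+1)%N by exact: ltnW.
have nz : ((k.+1 - m)%:R : K) != 0 by rewrite subSn ?natS_neq0 // -ltnS.
rewrite scalerA -{2}[h m]scale1r -scalerDl; congr (_ *: _).
by rewrite -{1}(subnK lem) natrD mulrDl mulfV // [m%:R * _]mulrC.
Qed.

(** Each of the [k] factors of [tad] contributes a bracket with [v]; spreading the factors outside
    that bracket by Leibniz adds up to the weights 1/(k - m). *)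
Lemma tder_tpow a s k f v xs : homop a f -> homop s v -> valid xs ->
  tder s (tpow k f) v xs = tpow k (tder s f v) xs
  + \sum_(m < k) ((k - m)%:R)^-1 *: tbr s (tpow m f) (tpow (k - m.+1) v) xs.
Proof.
move=> hf hv; elim: k xs => [|k IH] xs hxs; first by rewrite big_ord0 addr0.
apply: (scalerI (natS_neq0 k)); rewrite scalerDr -tad_tpow.
rewrite (sum_weights_inv k (fun m => tbr s (tpow m f) (tpow (k - m) v) xs)).
rewrite -tderZ.
have -> : tder s (fun ys => k.+1%:R *: tpow k.+1 f ys) v xs = tder s (tad (tpow k f)) v xs.
  by apply: eq1_tder => // ys; rewrite tad_tpow.
rewrite tder_tad (eq_tad hxs (fun ys hy _ => IH ys hy)) /tad tbrDl tbr_suml.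
rewrite addrCA big_ord_recr /= subnn; congr (_ + _).
rewrite addrC addrAC; congr (_ + _); rewrite -big_split /=.
apply: eq_bigr => m _; rewrite tbrZl.
rewrite [X in _ *: X](tad_tbr (homop_tpow _ hf) (homop_tpow _ hv) hxs).
rewrite tbr_tad_tpowl tbr_tad_tpowr subnSK // scalerDr !scalerA mulVf ?scale1r //.
by rewrite -subnSK ?natS_neq0.
Qed.

(** * The series exp(- ad x) a and theta_x, and the Maurer-Cartan equation *)

(* [exp (- ad x) a] and [theta_x (f x)], cut off at a degree [N] that exceeds the lengths of all
   lists of interest. *)
Definition rho (N : nat) (a : G) : op := fun xs => \sum_(k < N) tpow k (tcst a) xs.
Definition theta (N : nat) (f : op) : op :=
  fun xs => \sum_(k < N) (k.+1%:R)^-1 *: tpow k f xs.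

(** Reindexes by k = m + n + 1 < N; the rest of the square vanishes by hypothesis. *)
Lemma sum_triangle N (h : nat -> nat -> G) :
  (forall m n, (N <= m + n.+1)%N -> h m n = 0) ->
  \sum_(k < N) \sum_(m < k) h m (k - m.+1)%N = \sum_(m < N) \sum_(n < N) h m n.
Proof.
move=> h0.
have -> : \sum_(k < N) \sum_(m < k) h m (k - m.+1)%N =
   \sum_(k < N) \sum_(m < N | (m < k)%N) h m (k - m.+1)%N.
  apply: eq_bigr => k _.
  by rewrite (big_ord_widen N (fun m => h m (k - m.+1)%N)) // ltnW.
rewrite (exchange_big_dep predT) //=; apply: eq_bigr => m _.
transitivity (\sum_(0 + m.+1 <= k < N) h m (k - m.+1)%N); first by rewrite big_geq_mkord.
rewrite big_addn -(big_mkord predT (h m)).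
rewrite [RHS](big_cat_nat (n := (N - m.+1)%N)) ?leq_subr //=.
rewrite [X in _ + X]big1_seq ?addr0; last first.
  move=> n /=; rewrite mem_index_iota => /andP [hn _]; apply: h0.
  by rewrite addnS -addSn -leq_subLR.
by apply: eq_bigr => i _; rewrite addnK.
Qed.

Lemma homop_tcst s a : homog s a -> homop s (tcst a).
Proof. by move=> ha [|x r] _ /=; rewrite ?addbF //; exact: homog0. Qed.

Lemma homop_sum s N (c : nat -> K) (F : nat -> op) : (forall k, homop s (F k)) ->
  homop s (fun xs => \sum_(k < N) c k *: F k xs).
Proof.
move=> hF xs hxs; apply: (big_ind (homog _)).
- exact: homog0.
- by move=> x y; exact: homogD.
- by move=> k _; apply: homogZ; exact: hF.
Qed.

Lemma homop_theta s N f : homop s f -> homop s (theta N f).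
Proof.
move=> hf; apply: (@homop_sum s N (fun k => k.+1%:R^-1) (fun k => tpow k f)) => k.
exact: homop_tpow.
Qed.

Lemma homop_rho s N a : homog s a -> homop s (rho N a).
Proof.
move=> ha xs hxs.
have := @homop_sum s N (fun=> 1) (fun k => tpow k (tcst a))
  (fun k => homop_tpow k (homop_tcst ha)) xs hxs.
by congr (homog _ _); apply: eq_bigr => k _; rewrite scale1r.
Qed.

(** With n = k - m - 1 the weight 1/(k - m) of [tder_tpow] becomes 1/(n + 1), the coefficient in
    [theta]. *)
Lemma tder_rho i s N a v xs : homog i a -> homop s v -> valid xs ->
  ((size xs).+1 < N)%N ->
  tder s (rho N a) v xs = tbr s (rho N a) (theta N v) xs.
Proof.
move=> ha hv hxs hN; rewrite /rho /theta tder_sum tbr_suml.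
transitivity (\sum_(k < N) \sum_(m < k) ((k - m.+1).+1%:R)^-1 *:
  tbr s (tpow m (tcst a)) (tpow (k - m.+1) v) xs).
  apply: eq_bigr => k _; rewrite (tder_tpow _ (homop_tcst ha) hv hxs).
  rewrite (eq1_tpow k (tder_tcst s a v)) tpow_f0 add0r.
  by apply: eq_bigr => m _; rewrite subnSK.
rewrite (sum_triangle (h := fun m n => n.+1%:R^-1 *: tbr s (tpow m (tcst a)) (tpow n v) xs)).
  by apply: eq_bigr => m _; rewrite tbr_sumr; apply: eq_bigr => n _; rewrite tbrZr.
move=> m n; rewrite addnS => hmn; rewrite tbr_tpow_small ?scaler0 //.
by rewrite -ltnS (leq_trans hN).
Qed.

Lemma tder_theta i s N f v xs : homop i f -> homop s v -> valid xs ->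
  ((size xs).+1 < N)%N ->
  tder s (theta N f) v xs = theta N (tder s f v) xs
  + \sum_(m < N) \sum_(n < N) ((m + n.+1).+1%:R^-1 * n.+1%:R^-1) *:
      tbr s (tpow m f) (tpow n v) xs.
Proof.
move=> hf hv hxs hN; rewrite /theta tder_sum.
transitivity (\sum_(k < N) (k.+1%:R^-1 *: tpow k (tder s f v) xs +
  \sum_(m < k) ((m + (k - m.+1).+1).+1%:R^-1 * (k - m.+1).+1%:R^-1) *:
  tbr s (tpow m f) (tpow (k - m.+1) v) xs)).
  apply: eq_bigr => k _; rewrite tderZ (tder_tpow _ hf hv hxs) scalerDr; congr (_ + _).
  rewrite scaler_sumr; apply: eq_bigr => m _.
  by rewrite subnSK // subnKC ?scalerA // ltnW.
rewrite big_split /=; congr (_ + _).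
rewrite (sum_triangle (h := fun m n => ((m + n.+1).+1%:R^-1 * n.+1%:R^-1) *:
   tbr s (tpow m f) (tpow n v) xs)) //.
move=> m n; rewrite addnS => hmn; rewrite tbr_tpow_small ?scaler0 //.
by rewrite -ltnS (leq_trans hN).
Qed.

Lemma tbr_tcst s a b xs : tbr s (tcst a) (tcst b) xs = tcst (br a b) xs.
Proof. by case: xs => [|x r] //=; rewrite tbr_f0l tbr_f0r ssign0 addr0. Qed.

(** The exponential of the derivation [tad] is an automorphism, by [tpow_tbr]. *)
Lemma tbr_rho i s N a b xs : homog i a -> homog s b -> valid xs -> (size xs < N)%N ->
  tbr s (rho N a) (rho N b) xs = rho N (br a b) xs.
Proof.
move=> ha hb hxs hN; rewrite /rho tbr_suml.
under eq_bigr => m _ do rewrite tbr_sumr.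
(* [sum_triangle] pairs indices with m + n + 1 = k, whereas here m + n = k; the range N + 1 absorbs
   the shift, and the added terms vanish. *)
transitivity (\sum_(m < N.+1) \sum_(n < N.+1)
   tbr s (tpow m (tcst a)) (tpow n (tcst b)) xs).
  rewrite [RHS]big_ord_recr /= [X in _ = _ + X]big1 ?addr0; last first.
    by move=> n _; apply: tbr_tpow_small => //; rewrite ltn_addr.
  apply: eq_bigr => m _; rewrite big_ord_recr /= [X in _ = _ + X]tbr_tpow_small ?addr0 //.
  by rewrite ltn_addl.
rewrite -(sum_triangle (h := fun m n => tbr s (tpow m (tcst a)) (tpow n (tcst b)) xs)).
  rewrite big_ord_recl big_ord0 add0r; apply: eq_bigr => k _ /=.
  rewrite -(eq1_tpow k (tbr_tcst s a b)) (tpow_tbr k (homop_tcst ha) (homop_tcst hb) hxs).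
  by apply: eq_bigr => m _; rewrite -[(k - m)%N]subSS.
move=> m n; rewrite addnS ltnS => hmn; rewrite tbr_tpow_small //.
exact: leq_trans hN hmn.
Qed.

Lemma pE_tder s f g xs : pE (tder s f g xs) = tder s (fun ys => pE (f ys)) g xs.
Proof.
by elim: xs s f g => [|x r IH] s f g //=; rewrite pED pE_ssign !IH.
Qed.

Lemma pE_tder_eq0 s f g xs : homop s g -> valid xs ->
  (forall ys, valid ys -> (size ys <= (size xs).+1)%N -> pE (f ys) = 0) ->
  pE (tder s f g xs) = 0.
Proof.
move=> hg hxs hf; rewrite pE_tder -[RHS](tder_f0 s g xs).
exact: eq_tder.
Qed.

(** This is where [H] being a subalgebra enters. *)
Lemma pE_tbr_eq0 s f g xs : valid xs ->
  (forall ys, valid ys -> (size ys <= size xs)%N -> pE (f ys) = 0) ->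
  (forall ys, valid ys -> (size ys <= size xs)%N -> pE (g ys) = 0) ->
  pE (tbr s f g xs) = 0.
Proof.
elim: xs s f g => [|x r IH] s f g /=; first by move=> _ hf hg; rewrite pE_br ?hf ?hg.
case=> hx hr hf hg; rewrite pED pE_ssign !IH ?ssign0 ?addr0 // => ys hy hs.
- by apply: hf.
- by apply: hg => //; exact: leqW.
- by apply: hf => //; exact: leqW.
- by apply: hg.
Qed.

Lemma thetaL N k f g xs :
  theta N (fun ys => k *: f ys + g ys) xs = k *: theta N f xs + theta N g xs.
Proof.
rewrite /theta scaler_sumr -big_split; apply: eq_bigr => i _ /=.
by rewrite tpowL scalerDr !scalerA [k * _]mulrC.
Qed.

Lemma rhoL N k a b xs : rho N (k *: a + b) xs = k *: rho N a xs + rho N b xs.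
Proof.
rewrite /rho scaler_sumr -big_split; apply: eq_bigr => i _ /=.
rewrite -tpowL; apply: eq1_tpow => -[|x r] //=.
by rewrite scaler0 addr0.
Qed.

Lemma eq1_theta N f g : f =1 g -> theta N f =1 theta N g.
Proof. by move=> h xs; apply: eq_bigr => k _; rewrite (eq1_tpow k h). Qed.

Lemma tbr_theta s N f g xs : tbr s (theta N f) (theta N g) xs =
  \sum_(m < N) \sum_(n < N) (m.+1%:R^-1 * n.+1%:R^-1) *: tbr s (tpow m f) (tpow n g) xs.
Proof.
rewrite /theta tbr_suml; apply: eq_bigr => m _.
rewrite tbr_sumr; apply: eq_bigr => n _.
by rewrite tbrZl tbrZr scalerA.
Qed.

(** Symmetrizing the weight of [tder_theta] in m and n makes it a product, namely the weight of
    [tbr_theta]. *)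
Lemma inv_natS_add m n :
  ((m + n.+1).+1%:R^-1 * n.+1%:R^-1 + (n + m.+1).+1%:R^-1 * m.+1%:R^-1 : K)
  = m.+1%:R^-1 * n.+1%:R^-1.
Proof.
rewrite [(n + m.+1)%N]addnC addSnnS -mulrDr.
have hm := natS_neq0 m; have hn := natS_neq0 n; have hs := natS_neq0 (m + n.+1).
apply: (mulfI hs); rewrite mulrA mulfV // mul1r.
rewrite -addSn natrD mulrDl [X in _ = X + _]mulrA mulfV // mul1r.
by rewrite [X in _ = _ + X]mulrCA mulfV // mulr1.
Qed.

Lemma maurer_cartan i s N f g xs : homop i f -> homop s g -> valid xs ->
  ((size xs).+1 < N)%N ->
  tder s (theta N f) g xs - ssign (i && s) (tder i (theta N g) f xs) =
  theta N (fun ys => tder s f g ys - ssign (i && s) (tder i g f ys)) xs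
  + tbr s (theta N f) (theta N g) xs.
Proof.
move=> hf hg hxs hN; rewrite !(tder_theta (i := i) (s := s)) // (tder_theta (i := s)) //.
have -> : theta N (fun ys => tder s f g ys - ssign (i && s) (tder i g f ys)) xs
  = theta N (tder s f g) xs - ssign (i && s) (theta N (tder i g f) xs).
  rewrite -[in RHS]scaleN1r ssignE scalerA addrC -thetaL.
  by apply: eq1_theta => ys; rewrite ssignE -scaleN1r scalerA addrC.
rewrite ssignD opprD addrACA; congr (_ + _).
rewrite tbr_theta ssignE scaler_sumr -sumrN -[RHS]addr0.
under [X in _ + X]eq_bigr => m _ do rewrite scaler_sumr -sumrN.
(* After the exchange of m and n and one use of antisymmetry both double sums run over the same
   brackets, so that only their weights have to be added. *)
rewrite [X in _ + X]exchange_big -big_split addr0; apply: eq_bigr => m _.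
rewrite -big_split; apply: eq_bigr => n _ /=.
rewrite (tbr_antisym (homop_tpow n hg) (homop_tpow m hf) hxs) !ssignE.
rewrite !scalerN opprK !scalerA mulrAC [s && i]andbC -expr2 sqrr_sign mul1r.
by rewrite -scalerDl inv_natS_add.
Qed.

(** The commutator of solutions for [a] and [b] solves the equation for [br a b]. *)
Lemma fundamental_bracket i s N a b f g xs :
  homog i a -> homog s b -> homop i f -> homop s g ->
  (forall ys, valid ys -> (size ys < N)%N -> pE (rho N a ys) = pE (theta N f ys)) ->
  (forall ys, valid ys -> (size ys < N)%N -> pE (rho N b ys) = pE (theta N g ys)) ->
  valid xs -> ((size xs).+1 < N)%N ->
  pE (rho N (br a b) xs) =
  pE (theta N (fun ys => tder s f g ys - ssign (i && s) (tder i g f ys)) xs).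
Proof.
move=> ha hb hf hg ea eb hxs hN.
(* The [H]-valued series W_a and W_b, in the shape that the linearity lemmas expect. *)
pose Wa ys := -1 *: theta N f ys + rho N a ys.
pose Wb ys := -1 *: theta N g ys + rho N b ys.
have Wa0 ys : valid ys -> (size ys < N)%N -> pE (Wa ys) = 0.
  by move=> hy hs; rewrite pEL ea // scaleN1r addNr.
have Wb0 ys : valid ys -> (size ys < N)%N -> pE (Wb ys) = 0.
  by move=> hy hs; rewrite pEL eb // scaleN1r addNr.
have Da : pE (tder s Wa g xs) = 0.
  by apply: pE_tder_eq0 => // ys hy hs; apply: Wa0 => //; exact: leq_ltn_trans hs hN.
have Db : pE (tder i Wb f xs) = 0.
  by apply: pE_tder_eq0 => // ys hy hs; apply: Wb0 => //; exact: leq_ltn_trans hs hN.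
have hN' := ltnW hN.
have Dab : pE (tbr s Wa Wb xs) = 0.
  by apply: pE_tbr_eq0 => // ys hy hs; [apply: Wa0 | apply: Wb0] => //;
     exact: leq_ltn_trans hs hN'.
apply/eqP; rewrite -subr_eq0 -pEB; apply/eqP.
(* Every term on the right is [H]-valued: two derivatives of [H]-valued series and a bracket of two
   such series. *)
suff -> : rho N (br a b) xs -
   theta N (fun ys => tder s f g ys - ssign (i && s) (tder i g f ys)) xs =
   tder s Wa g xs - ssign (i && s) (tder i Wb f xs) + tbr s Wa Wb xs.
  by rewrite pED pEB pE_ssign Da Db Dab ssign0 subrr addr0.
have MC := maurer_cartan hf hg hxs hN.
rewrite -(tbr_rho ha hb hxs hN') /Wa /Wb !tderL !tbrLl !tbrLr.
rewrite (tder_rho ha hg hxs hN) (tder_rho hb hf hxs hN).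
rewrite (tbr_antisym (homop_rho N hb) (homop_theta N hf) hxs).
rewrite ssignD [ssign _ (- _)]ssignE scalerN -ssignE ssign_ssign [s && i]andbC addbb.
rewrite ssignZ !scaleN1r [ssign false _]/=.
have -> : tder s (theta N f) g xs =
  theta N (fun ys => tder s f g ys - ssign (i && s) (tder i g f ys)) xs
  + tbr s (theta N f) (theta N g) xs + ssign (i && s) (tder i (theta N g) f xs).
  by rewrite -MC subrK.
by zmod_cancel.
Qed.

(** * Existence and uniqueness of the solution by iteration *)

(* Picard iteration for the equation [pE (rho N a - theta N f) = 0], [pE f = f]; step [M] is exact
   on lists shorter than [M]. *)
Fixpoint picard (N : nat) (a : G) (M : nat) : op :=
  if M is M'.+1 then
    fun xs => picard N a M' xs + pE (rho N a xs - theta N (picard N a M') xs)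
  else fun=> 0.

Lemma pE_picard N a M xs : pE (picard N a M xs) = picard N a M xs.
Proof. by elim: M xs => [|M IH] xs /=; rewrite ?pE0 // pED pE_id IH. Qed.

(** theta_x is the identity plus terms containing [tad], and these read [f] only on shorter
    lists. *)
Lemma theta_lowest N f xs : valid xs -> (0 < N)%N ->
  (forall ys, valid ys -> (size ys < size xs)%N -> f ys = 0) ->
  theta N f xs = f xs.
Proof.
case: N => // N hxs _ hf; rewrite /theta big_ord_recl big1 => [|k _].
  by rewrite addr0 invr1 scale1r.
rewrite (_ : tpow _ f xs = 0) ?scaler0 // -[RHS](tpow_f0 (lift ord0 k) xs).
apply: eq_tpow => // ys hy hs; apply: hf => //.
by rewrite -hs lift0 addnS ltnS leq_addr.
Qed.

(** Since theta_x starts with the identity, the equation determines each coefficient of an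
    [E]-valued solution from those of lower degree. *)
Lemma picard_unique N a f M xs : (0 < N)%N ->
  (forall ys, valid ys -> (size ys < M)%N ->
     pE (f ys) = f ys /\ pE (rho N a ys) = pE (theta N f ys)) ->
  valid xs -> (size xs < M)%N -> f xs = picard N a M xs.
Proof.
move=> hN; elim: M xs => [|M IH] xs // hf hxs hs /=.
have IH' ys : valid ys -> (size ys < M)%N -> f ys = picard N a M ys.
  by move=> hy hsy; apply: IH => // zs hz hsz; apply: hf => //; exact: leqW.
have [fE eqf] := hf xs hxs hs.
rewrite pEB eqf -pEB.
(* The difference of the two series vanishes below degree [M], so [theta] acts on it as the identity
   at [xs]. *)
have -> : theta N f xs - theta N (picard N a M) xs =
          theta N (fun ys => -1 *: picard N a M ys + f ys) xs.
  by rewrite thetaL scaleN1r addrC.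
rewrite theta_lowest // ?pEL ?pE_picard ?fE ?scaleN1r ?addNKr ?addKr //.
move=> ys hy hsy; rewrite IH' // ?scaleN1r ?addNr //.
exact: leq_trans hsy _.
Qed.

(** Linearity, parity and symmetry follow by induction for the iteration; [tseries_picard] transfers
    them to the a(p). *)
Lemma picardL N k a b M xs :
  picard N (k *: a + b) M xs = k *: picard N a M xs + picard N b M xs.
Proof.
elim: M xs => [|M IH] xs /=; first by rewrite scaler0 addr0.
rewrite (eq1_theta N IH) IH thetaL rhoL !pEB !pEL scalerDr scalerBr.
zmod_cancel.
Qed.

Lemma homop_picard s N a M : homog s a -> homop s (picard N a M).
Proof.
move=> ha; elim: M => [|M IH] xs hxs /=; first exact: homog0.
apply: homogD; first exact: IH.
rewrite addrC -scaleN1r; apply: homog_pE; apply: homogL.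
  exact: homop_theta.
exact: homop_rho.
Qed.

(** * Graded symmetry and multilinearity *)

Definition symop (f : op) : Prop := forall l x y r, valid (l ++ x :: y :: r) ->
  f (l ++ y :: x :: r) = ssign (x.1 && y.1) (f (l ++ x :: y :: r)).
(** An [op] is an arbitrary function on lists, so multilinearity has to be required explicitly; it
    makes sense slot by slot within one parity. *)
Definition linop (f : op) : Prop := forall l b x y r k,
  valid (l ++ (b, x) :: r) -> homog b y ->
  f (l ++ (b, k *: x + y) :: r) = k *: f (l ++ (b, x) :: r) + f (l ++ (b, y) :: r).
Definition symlinop (f : op) : Prop := symop f /\ linop f.

Lemma symlinop_app f x : homog x.1 x.2 -> symlinop f -> symlinop (app f x).
Proof.
move=> hx [h1 h2]; split=> [l y z r h|l b y z r k h hz].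
  by apply: (h1 (x :: l)).
by apply: (h2 (x :: l)).
Qed.

Lemma symlinopL k f g : symlinop f -> symlinop g -> symlinop (fun ys => k *: f ys + g ys).
Proof.
move=> [f1 f2] [g1 g2]; split=> [l y z r h|l b y z r c h hz].
  by rewrite f1 // g1 // ssignD ssignZ.
by rewrite f2 // g2 // !scalerDr !scalerA [k * c]mulrC addrACA.
Qed.

Lemma symlinop0 : symlinop (fun=> 0).
Proof. by split=> [l x y r _|l b x y r k _ _]; rewrite ?ssign0 ?scaler0 ?addr0. Qed.

Lemma eq1_symlinop f g : f =1 g -> symlinop f -> symlinop g.
Proof.
move=> h [f1 f2]; split=> [l x y r ?|l b x y r k ? ?]; rewrite -!h.
  exact: f1.
exact: f2.
Qed.

Lemma symlinop_sum N (c : nat -> K) (F : nat -> op) : (forall k, symlinop (F k)) ->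
  symlinop (fun xs => \sum_(k < N) c k *: F k xs).
Proof.
move=> hF; elim: N => [|N IH].
  by apply: (eq1_symlinop _ symlinop0) => xs; rewrite big_ord0.
by apply: (eq1_symlinop _ (symlinopL (c N) (hF N) IH)) => xs; rewrite big_ord_recr addrC.
Qed.

Lemma symlinop_pE f : symlinop f -> symlinop (fun ys => pE (f ys)).
Proof.
move=> [f1 f2]; split=> [l x y r ?|l b x y r k ? ?]; first by rewrite f1 // pE_ssign.
by rewrite f2 // pEL.
Qed.

Lemma symlinop_tcst a : symlinop (tcst a).
Proof.
by split=> [[|z l] x y r _|[|z l] b x y r k _ _] /=; rewrite ?ssign0 ?scaler0 ?addr0.
Qed.

Lemma symlinop_tid : symlinop tid.
Proof.
by split=> [[|z [|z' l]] x y r _|[|z [|z' l]] b x y [|t r] k _ _] /=;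
   rewrite ?ssign0 ?scaler0 ?addr0.
Qed.

(** Up to sign, swapping the first two arguments exchanges the mixed Leibniz terms and preserves
    those with both derivatives on one factor. *)
Lemma symlinop_tbr s f g : symlinop f -> symlinop g -> symlinop (tbr s f g).
Proof.
move=> hf hg; split=> l.
  elim: l s f g hf hg => [|z l IH] s f g hf hg x y r /=; last first.
    case=> hz h; rewrite (IH _ _ _ hf (symlinop_app hz hg) _ _ _ h).
    rewrite (IH _ _ _ (symlinop_app hz hf) hg _ _ _ h).
    by rewrite ssignD !ssign_ssign [z.1 && s (+) _]addbC.
  case=> hx [hy hr].
  have -> : tbr ((s (+) y.1) (+) x.1) f (app (app g y) x) r =
    ssign (x.1 && y.1) (tbr ((s (+) y.1) (+) x.1) f (app (app g x) y) r).
    rewrite -tbr_ssignr; apply: eq_tbr => // zs hz _.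
    by apply: (hg.1 [::]).
  have -> : tbr s (app (app f y) x) g r = ssign (x.1 && y.1) (tbr s (app (app f x) y) g r).
    rewrite -tbr_ssignl; apply: eq_tbr => // zs hz _.
    by apply: (hf.1 [::]).
  by case: (x.1) (y.1) s {hx hy} => [] [] [] /=; zmod_cancel.
elim: l s f g hf hg => [|z l IH] s f g hf hg b x y r k /=; last first.
  case=> hz h hy; rewrite (IH _ _ _ hf (symlinop_app hz hg) _ _ _ _ _ h hy).
  rewrite (IH _ _ _ (symlinop_app hz hf) hg _ _ _ _ _ h hy).
  by rewrite ssignD ssignZ scalerDr addrACA.
case=> hx hr hy; rewrite scalerDr -ssignZ addrACA -ssignD -tbrLr -tbrLl.
congr (_ + ssign _ _).
  by apply: eq_tbr => // zs hz _; apply: (hg.2 [::]).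
by apply: eq_tbr => // zs hz _; apply: (hf.2 [::]).
Qed.

Lemma symlinop_tpow k f : symlinop f -> symlinop (tpow k f).
Proof.
move=> hf; elim: k => [|k IH] //=.
have h := symlinop_tbr false IH symlinop_tid.
apply: (eq1_symlinop _ (symlinopL (k.+1%:R^-1) h symlinop0)) => xs.
by rewrite addr0.
Qed.

Lemma symlinop_picard N a M : symlinop (picard N a M).
Proof.
elim: M => [|M IH] /=; first exact: symlinop0.
have h1 : symlinop (rho N a).
  have := @symlinop_sum N (fun=> 1) _ (fun k => symlinop_tpow k (symlinop_tcst a)).
  by apply: eq1_symlinop => xs; apply: eq_bigr => k _; rewrite scale1r.
have h2 : symlinop (theta N (picard N a M)).
  exact: (@symlinop_sum N (fun k => k.+1%:R^-1) _ (fun k => symlinop_tpow k IH)).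
apply: (eq1_symlinop _ (symlinopL 1 IH (symlinop_pE (symlinopL (-1) h2 h1)))) => xs.
by rewrite scale1r scaleN1r [- _ + _]addrC.
Qed.

(** * The operators a(p) as Taylor coefficients of the series V_a *)

Lemma obr_cons p q A B x r : (0 < p + q)%N ->
  obr ev br p q A B (x :: r) = ((p + q)%:R)^-1 *:
   ((if q is q'.+1 then q%:R *: obr ev br p q' A (app B x) r else 0)
    + (if p is p'.+1 then
         p%:R *: (obr ev br p' q (app A x) (opPar ev false B) r
                  + ssign x.1 (obr ev br p' q (app A x) (opPar ev true B) r))
       else 0)).
Proof. by case: p q => [|p] [|q]. Qed.

Lemma opPar_homog s b B xs : homog (s (+) psum xs) (B xs) ->
  opPar ev b B xs = if b == s then B xs else 0.
Proof.
move=> h; rewrite /opPar (proj_homog _ h).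
by case: (psum xs) b s {h} => [] [] [].
Qed.

(** Factorials turn the weighted recursion of [obr] into the plain Leibniz rule. The scalars [c] and
    [d] absorb the factors that arise when [p] or [q] drops; [g] must vanish off length [q], so that
    no other distribution of the arguments contributes. *)
Lemma tbr_obr p q A B s f g c d xs : valid xs -> size xs = (p + q)%N ->
  (forall ys, valid ys -> size ys = p -> f ys = (c * p`!%:R) *: A ys) ->
  (forall ys, valid ys -> g ys = if size ys == q then (d * q`!%:R) *: B ys else 0) ->
  (forall ys, valid ys -> size ys = q -> homog (s (+) psum ys) (B ys)) ->
  tbr s f g xs = (c * d * (p + q)`!%:R) *: obr ev br p q A B xs.
Proof.
elim: xs p q A B s f g c d => [|x r IH] p q A B s f g c d.
  move=> _ /esym /eqP; rewrite addn_eq0 => /andP [/eqP -> /eqP ->] hf hg _ /=.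
  by rewrite hf // hg //= brZl brZr scalerA !mulr1.
move=> /= [hx hr] hs hf hg hB; rewrite -/(obr ev br p q A B (x :: r)).
have pq0 : (0 < p + q)%N by rewrite -hs.
rewrite obr_cons //.
have [n pqE] : exists n, (p + q)%N = n.+1 by exists (size r).
have sr : size r = n by move: hs; rewrite pqE => -[].
have -> : (c * d * (p + q)`!%:R) = (c * d * n`!%:R) * (p + q)%:R.
  by rewrite pqE factS natrM mulrA mulrAC.
rewrite scalerA -mulrA mulfV ?mulr1; last by rewrite pqE natS_neq0.
rewrite scalerDr; congr (_ + _).
  case: q hs hg hB pqE {pq0} => [|q] hs hg hB pqE.
    rewrite scaler0 -[RHS](tbr_f0r (s (+) x.1) f r); apply: eq_tbr => // ys hy _.
    by rewrite /app hg.
  have pqE' : (p + q)%N = n by move: pqE; rewrite addnS => -[].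
  rewrite (IH p q A (app B x) _ f (app g x) c (d * q.+1%:R)) //.
  - by rewrite pqE' scalerA mulrA mulrAC.
  - by rewrite pqE'.
  - by move=> ys hy; rewrite /app hg //= eqSS factS natrM mulrA.
  - by move=> ys hy hsy; rewrite -addbA; apply: (hB (x :: ys)) => //=; rewrite hsy.
case: p hs hf pqE {pq0} => [|p] hs hf pqE.
  rewrite scaler0 (_ : tbr s _ g r = 0) ?ssign0 //.
  rewrite -[RHS](tbr_f0r s (app f x) r); apply: eq_tbr => // ys hy hsy.
  by rewrite hg // -[q]add0n pqE; case: eqP => // e; move: hsy; rewrite e sr ltnn.
have pqE' : (p + q)%N = n by move: pqE; rewrite addSn => -[].
(* Of the two parity components of [B] only [b = s] survives; the pair of terms in [obr] becomes the
   single signed term of [tbr]. *)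
have step b : tbr b (app f x) (fun ys => if b == s then g ys else 0) r =
   (c * d * n`!%:R) *: (p.+1%:R *: obr ev br p q (app A x) (opPar ev b B) r).
  rewrite (IH p q (app A x) (opPar ev b B) b _ _ (c * p.+1%:R) d) //.
  - by rewrite pqE' scalerA -!mulrA [p.+1%:R * _]mulrC !mulrA.
  - by rewrite pqE'.
  - by move=> ys hy hsy; rewrite /app hf //= ?hsy // factS natrM mulrA.
  - move=> ys hy; rewrite hg //; case: (size ys =P q) => [hsy|_]; last by case: ifP.
    by rewrite (opPar_homog b (hB ys hy hsy)); case: ifP; rewrite ?scaler0.
  - by move=> ys hy hsy; exact: homog_proj.
rewrite !scalerDr -!ssignZ -!step.
by case: (s) => /=; rewrite tbr_f0r ?ssign0 ?add0r ?addr0 ?andbT ?andbF.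
Qed.

Lemma tpow_iterbr m A k f xs : valid xs -> size xs = (m + k)%N ->
  (forall ys, valid ys -> size ys = m -> f ys = m`!%:R *: A ys) ->
  tpow k f xs = (k`!%:R^-1 * (m + k)`!%:R) *: iterbr ev br m A k xs.
Proof.
move=> + + hf; elim: k xs => [|k IH] xs hxs hs /=.
  by rewrite hf // ?hs ?addn0 // invr1 mul1r.
rewrite /tad (@tbr_obr (m + k) 1 (iterbr ev br m A k) (@idop K G) false _ _ k`!%:R^-1 1) //.
- by rewrite scalerA factS natrM invfM mulr1 addn1 addnS mulrA.
- by rewrite hs addn1 addnS.
- by move=> [|y [|z ys]] //= _; rewrite mulr1 scale1r.
- by move=> [|y [|z ys]] //= [hy _] _; rewrite addbF.
Qed.

Lemma size_alist a n : size (alist ev br pE a n) = n.+1.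
Proof. by elim: n => //= n IH; rewrite size_rcons IH. Qed.

Lemma nth_alist a n q : (q <= n)%N ->
  nth (cst 0) (alist ev br pE a n) q = acomp ev br pE a q.
Proof.
elim: n => [|n IH]; first by rewrite leqn0 => /eqP ->.
rewrite leq_eqVlt => /orP [/eqP -> //|]; rewrite ltnS => h.
by rewrite /= nth_rcons size_alist ltnS h IH.
Qed.

Lemma acompE a p xs : acomp ev br pE a p xs =
  (p`!%:R)^-1 *: pE (iterbr ev br 0 (cst a) p xs)
  - \sum_(q < p) (((p - q).+1)`!%:R)^-1 *:
      pE (iterbr ev br q (acomp ev br pE a q) (p - q) xs).
Proof.
case: p => [|p]; first by rewrite big_ord0 subr0 invr1 scale1r.
rewrite {1}/acomp /= nth_rcons size_alist ltnn eqxx /anext; congr (_ - _).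
by apply: eq_bigr => q _; rewrite nth_alist // -ltnS.
Qed.

Definition tseries (a : G) : op :=
  fun xs => (size xs)`!%:R *: acomp ev br pE a (size xs) xs.

Lemma pE_acomp a p xs : pE (acomp ev br pE a p xs) = acomp ev br pE a p xs.
Proof.
rewrite acompE pEB pEZ pE_id pE_sum; congr (_ - _).
by apply: eq_bigr => q _; rewrite pEZ pE_id.
Qed.

Lemma pE_tseries a xs : pE (tseries a xs) = tseries a xs.
Proof. by rewrite pEZ pE_acomp. Qed.

(** [tcst a] lives on the empty list, so only the power equal to the number of arguments
    contributes. *)
Lemma rhoE N a xs : valid xs -> (size xs < N)%N ->
  rho N a xs = iterbr ev br 0 (cst a) (size xs) xs.
Proof.
move=> hxs hs; rewrite /rho (bigD1 (Ordinal hs)) //= big1 ?addr0.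
  rewrite (@tpow_iterbr 0 (cst a)) // ?add0n ?mulVf ?fact_neq0 ?scale1r //.
  by move=> [|y ys] //= _ _; rewrite scale1r.
move=> k /eqP hk; rewrite -[RHS](tpow_f0 k xs); apply: eq_tpow => // -[|y ys] //= _ e.
by case: hk; apply: val_inj; rewrite /= -e.
Qed.

(** In degree p this is p! times the recursion for a(p): the power k = p - q of [tad] on a(q) has
    weight 1/(k + 1) times 1/k!, which is the 1/(k + 1)! of the recursion. *)
Lemma tseries_eq N a xs : valid xs -> (size xs < N)%N ->
  pE (rho N a xs) = pE (theta N (tseries a) xs).
Proof.
move=> hxs hs; rewrite rhoE //; set p := size xs in hs *.
have -> : theta N (tseries a) xs =
  \sum_(k < p.+1) k.+1%:R^-1 *: tpow k (tseries a) xs.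
  rewrite /theta [RHS](big_ord_widen N (fun k => k.+1%:R^-1 *: tpow k (tseries a) xs)) //.
  rewrite [LHS](bigID (fun k : 'I_N => (k < p.+1)%N)) /= [X in _ + X]big1 ?addr0 //.
  by move=> k; rewrite -leqNgt => hk; rewrite tpow_small ?scaler0.
(* The reversed index is the order q of a(q); its last value isolates the term with a(p). *)
rewrite (reindex_inj rev_ord_inj) /= big_ord_recr /= subnn invr1 scale1r.
rewrite pED pE_tseries {2}/tseries acompE scalerBr scalerA mulfV ?fact_neq0 // scale1r.
rewrite -/p pE_sum scaler_sumr.
suff -> : \sum_(i < p) pE ((p.+1 - i.+1).+1%:R^-1 *: tpow (p.+1 - i.+1) (tseries a) xs) =
  \sum_(i < p) p`!%:R *: (((p - i).+1)`!%:R^-1 *: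
      pE (iterbr ev br i (acomp ev br pE a i) (p - i) xs)) by rewrite addrC subrK.
apply: eq_bigr => i _; rewrite subSS pEZ.
have hi : (i + (p - i))%N = p by rewrite subnKC // ltnW.
rewrite (@tpow_iterbr i (acomp ev br pE a i)) // ?hi //.
  rewrite pEZ !scalerA factS natrM invfM; congr (_ *: _).
  by rewrite [RHS]mulrC [LHS]mulrA.
by move=> ys hy <-.
Qed.

Lemma tseries_picard a M xs : valid xs -> (size xs < M)%N ->
  tseries a xs = picard M a M xs.
Proof.
move=> hxs hs; apply: picard_unique => //; first exact: leq_trans hs.
by move=> ys hy hsy; split; [exact: pE_tseries | exact: tseries_eq].
Qed.

Lemma acomp_tseries a p ys : size ys = p ->
  acomp ev br pE a p ys = (p`!%:R)^-1 *: tseries a ys.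
Proof. by move=> <-; rewrite scalerA mulVf ?fact_neq0 // scale1r. Qed.

Lemma tseriesL k a b xs : valid xs ->
  tseries (k *: a + b) xs = k *: tseries a xs + tseries b xs.
Proof. by move=> hxs; rewrite !(tseries_picard _ hxs (leqnn _)) picardL. Qed.

Lemma homop_tseries s a : homog s a -> homop s (tseries a).
Proof.
by move=> ha xs hxs; rewrite (tseries_picard _ hxs (leqnn _)); exact: homop_picard.
Qed.

Lemma valid_swap l x y r : valid (l ++ x :: y :: r) -> valid (l ++ y :: x :: r).
Proof. by elim: l => [|z l IH] /= [h]; [case | move=> /IH]. Qed.

Lemma valid_replace l b x y r :
  valid (l ++ (b, x) :: r) -> homog b y -> valid (l ++ (b, y) :: r).
Proof. by move=> + hy; elim: l => [|z l IH] /= [h] // /IH. Qed.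

Lemma symlinop_tseries a : symlinop (tseries a).
Proof.
split=> [l x y r h|l b x y r k h hy].
  have [g _] := symlinop_picard (size (l ++ x :: y :: r)).+1 a (size (l ++ x :: y :: r)).+1.
  rewrite (tseries_picard a h (leqnn _)) (tseries_picard a (valid_swap h) (leqnn _)).
  rewrite -g // (_ : size (l ++ y :: x :: r) = size (l ++ x :: y :: r)) //.
  by rewrite !size_cat.
have hx : homog b x.
  by move: h; elim: (l) => [|z l' IH] /= [].
have hxy : valid (l ++ (b, k *: x + y) :: r) by apply: valid_replace h _; exact: homogL.
have h2 := valid_replace h hy.
pose M := (size (l ++ (b, x) :: r)).+1.
have [_ g] := symlinop_picard M a M.
rewrite (@tseries_picard a M) // ?(@tseries_picard a M _ h) ?(@tseries_picard a M _ h2) //.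
- exact: g.
- by rewrite /M !size_cat.
- by rewrite /M !size_cat.
Qed.

(** * The composition of operators as a directional derivative *)

Lemma eq_compo p q A A' B B' xs : valid xs -> (0 < p)%N -> (size xs).+1 = (p + q)%N ->
  (forall ys, valid ys -> size ys = p -> A ys = A' ys) ->
  (forall ys, valid ys -> size ys = q -> B ys = B' ys) ->
  compo ev p q A B xs = compo ev p q A' B' xs.
Proof.
have base n A1 A2 y zs : valid zs -> (size zs).+1 = n ->
    (forall ys, valid ys -> size ys = n -> A1 ys = A2 ys) ->
    app_elem ev A1 y zs = app_elem ev A2 y zs.
  by move=> hz hs h; congr (_ + _); apply: h => //; split=> //; exact: homog_proj.
elim: xs p q A A' B B' => [|x r IH] p [|q] A A' B B' //=.
- by rewrite addn0 => _ _ hs hA hB; rewrite hB //; apply: (base p).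
- by rewrite addn0 => hxs _ hs hA hB; rewrite hB //; apply: (base p).
case=> hx hr p0 hs hA hB.
have hs' : (size r).+1 = (p + q)%N by move: hs; rewrite addnS => -[].
congr (_ + _).
  by apply: IH => // ys hy hsy; apply: hB => //=; rewrite hsy.
case: p p0 hs hs' hA => [|[|p]] // _ hs hs' hA /=.
by congr (_ + ssign _ _); apply: IH => //; rewrite ?addnS // => ys hy hsy;
   [apply: hA => //=; rewrite hsy | rewrite /opPar hB
   | apply: hA => //=; rewrite hsy | rewrite /opPar hB].
Qed.

Lemma compoLl p q k A A' B xs :
  compo ev p q (fun ys => k *: A ys + A' ys) B xs =
  k *: compo ev p q A B xs + compo ev p q A' B xs.
Proof.
elim: xs p q A A' B => [|x r IH] p [|q] A A' B /=.
- by rewrite /app_elem scalerDr addrACA.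
- by rewrite scaler0 addr0.
- by rewrite /app_elem scalerDr addrACA.
rewrite IH scalerDr addrACA; congr (_ + _); case: ifP => _; last first.
  by rewrite scaler0 addr0.
by rewrite !(IH _ _ (app A x) (app A' x)) ssignD ssignZ scalerDr addrACA.
Qed.

(** The value of [B] becomes an argument of [A], so linearity in [B] rests on the multilinearity of
    [A]. *)
Lemma compoLr p q k A B B' xs :
  symlinop A -> valid xs -> (0 < p)%N -> (size xs).+1 = (p + q)%N ->
  compo ev p q A (fun ys => k *: B ys + B' ys) xs =
  k *: compo ev p q A B xs + compo ev p q A B' xs.
Proof.
have base A' y y' zs : symlinop A' -> valid zs ->
  app_elem ev A' (k *: y + y') zs = k *: app_elem ev A' y zs + app_elem ev A' y' zs.
  move=> [_ gA] hz; rewrite /app_elem !projL.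
  have e b : A' ((b, k *: proj b y + proj b y') :: zs) =
    k *: A' ((b, proj b y) :: zs) + A' ((b, proj b y') :: zs).
    by apply: (gA [::]); [split=> //; exact: homog_proj | exact: homog_proj].
  by rewrite !e scalerDr addrACA.
elim: xs p q A B B' => [|x r IH] p [|q] A B B' gA hxs p0 hs /=; try exact: base.
  by rewrite scaler0 addr0.
case: hxs => hx hr.
have hs' : (size r).+1 = (p + q)%N by move: hs; rewrite addnS => -[].
rewrite (IH p q A (app B x) (app B' x)) // scalerDr addrACA; congr (_ + _).
case: p p0 hs hs' => [|[|p]] // _ hs hs' /=; first by rewrite scaler0 addr0.
have e b : compo ev p.+1 q.+1 (app A x) (opPar ev b (fun ys => k *: B ys + B' ys)) r =
  k *: compo ev p.+1 q.+1 (app A x) (opPar ev b B) r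
  + compo ev p.+1 q.+1 (app A x) (opPar ev b B') r.
  rewrite -IH //; last 2 first.
  - exact: symlinop_app.
  - by rewrite addnS.
  by apply: eq_compo => //; rewrite ?addnS // => ys _ _; rewrite /opPar projL.
by rewrite !e ssignD ssignZ scalerDr addrACA.
Qed.

Lemma compo_f0r p q A B xs :
  symlinop A -> valid xs -> (0 < p)%N -> (size xs).+1 = (p + q)%N ->
  (forall ys, valid ys -> size ys = q -> B ys = 0) -> compo ev p q A B xs = 0.
Proof.
move=> gA hxs p0 hs hB.
(* As [B] vanishes, it agrees with [B + B], so the composition equals its own double. *)
have := compoLr 1 B B gA hxs p0 hs.
rewrite (@eq_compo p q A A (fun ys => 1 *: B ys + B ys) B) //; last first.
  by move=> ys hy hsy; rewrite hB // scaler0 addr0.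
by rewrite scale1r -[LHS]addr0 => /addrI.
Qed.

Lemma compoZ p q c d A B xs :
  symlinop A -> valid xs -> (0 < p)%N -> (size xs).+1 = (p + q)%N ->
  compo ev p q (fun ys => c *: A ys) (fun ys => d *: B ys) xs =
  (c * d) *: compo ev p q A B xs.
Proof.
move=> gA hxs p0 hs.
have split1 k (v : G) : k *: v = (k - 1) *: v + v by rewrite scalerBl scale1r subrK.
rewrite -scalerA [RHS]split1 [d *: _]split1 -compoLr // -compoLl.
by apply: eq_compo => // ys _ _; exact: split1.
Qed.

Lemma compo_order0 p A B xs : compo ev p 0 A B xs = app_elem ev A (B [::]) xs.
Proof. by case: xs. Qed.

(** The branch [q = 0] of [compo] does not test [p], but a list shorter than [q] never reaches it.
    This covers the boundary summands, where y o B = 0. *)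
Lemma compo0l q A B xs : (size xs < q)%N -> compo ev 0 q A B xs = 0.
Proof.
by elim: xs q A B => [|x r IH] [|q] A B //= h; rewrite IH // addr0.
Qed.

Lemma compo_cons s p q A B x r : symlinop A -> homop s B -> valid (x :: r) ->
  (0 < p)%N -> (size r).+1 = (p + q)%N ->
  compo ev p q.+1 A B (x :: r) = compo ev p q A (app B x) r +
  (if (1 < p)%N then ssign (x.1 && s) (compo ev p.-1 q.+1 (app A x) B r) else 0).
Proof.
move=> gA hB [hx hr] p0 hs /=; congr (_ + _).
case: p p0 hs => [|[|p]] // _ hs /=.
have e b : compo ev p.+1 q.+1 (app A x) (opPar ev b B) r =
  if b == s then compo ev p.+1 q.+1 (app A x) B r else 0.
  case: ifP => bs.
    apply: eq_compo => //; rewrite ?addnS // => ys hy _.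
    by rewrite (opPar_homog b (hB ys hy)) bs.
  apply: compo_f0r => //; rewrite ?addnS //; first exact: symlinop_app.
  by move=> ys hy _; rewrite (opPar_homog b (hB ys hy)) bs.
by rewrite !e; case: (s) => /=; rewrite ?ssign0 ?add0r ?addr0 ?andbT ?andbF.
Qed.

Lemma app_elem_homog s A y xs : symlinop A -> homog s y -> valid xs ->
  app_elem ev A y xs = A ((s, y) :: xs).
Proof.
move=> [_ gA] hy hxs.
have z b : A ((b, 0) :: xs) = 0.
  have := gA [::] b 0 0 xs 1 (conj (homog0 b) hxs) (homog0 b).
  by rewrite !scale1r addr0 -[LHS]addr0 => /addrI.
by rewrite /app_elem !(proj_homog _ hy); case: (s) => /=; rewrite z ?add0r ?addr0.
Qed.

(** The recursion of [compo] is the Leibniz rule sorted by the order q of the component of [g] that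
    is inserted. *)
Lemma tder_compo s f g xs : symlinop f -> homop s g -> valid xs ->
  tder s f g xs =
  \sum_(q < (size xs).+2) compo ev ((size xs).+1 - q) q f g xs.
Proof.
elim: xs s f g => [|x r IH] s f g gf hg hxs.
  rewrite !big_ord_recl big_ord0 /= !addr0 (@app_elem_homog s) //.
  by have := hg [::] I; rewrite addbF.
case: (hxs) => hx hr; have hg0 : homog s (g [::]) by have := hg [::] I; rewrite addbF.
rewrite [LHS]/= (IH _ f (app g x)) //; last exact: homop_app.
rewrite (IH _ (app f x) g) //; last exact: symlinop_app.
set n := size r; rewrite [size (x :: r)]/= -/n [RHS]big_ord_recl subn0.
have -> : \sum_(i < n.+2) compo ev (n.+2 - lift ord0 i) (lift ord0 i) f g (x :: r) =
  \sum_(i < n.+2) (compo ev (n.+1 - i) i f (app g x) r +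
  (if (1 < n.+1 - i)%N then
     ssign (x.1 && s) (compo ev (n.+1 - i).-1 i.+1 (app f x) g r) else 0)).
  apply: eq_bigr => i _; rewrite lift0 subSS.
  have [lein|] := leqP i n.
    apply: compo_cons => //; first by rewrite subn_gt0.
    by rewrite subnK // ltnW.
  (* The last index i = n + 1 has p = 0. *)
  move=> ltni; have -> : (n.+1 - i = 0)%N by apply/eqP; rewrite subn_eq0.
  by rewrite [X in _ = _ + X]/= addr0 !compo0l.
rewrite big_split /= addrCA; congr (_ + _).
rewrite big_ord_recl subn0 ssignD; congr (_ + _).
  (* For q = 0 the value of [g] precedes [x] in [compo] but follows it in [tder]; the symmetry of
     [f] reconciles the two. *)
  rewrite [X in ssign _ X](compo_order0 n.+1 (app f x) g).
  rewrite (app_elem_homog (s := s)) //; last exact: symlinop_app.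
  rewrite (app_elem_homog (s := s)) //.
  by rewrite /app (gf.1 [::] x (s, g [::]) r).
rewrite [RHS]big_ord_recr /= subnn addr0 ssignE scaler_sumr.
apply: eq_bigr => i _; rewrite -[bump 0 i]/(i.+1) subSS -ssignE.
have [lein|] := ltnP i n.
  by rewrite subSn ?(ltnW lein) // ltnS subn_gt0 lein.
move=> leni; have -> : i = n :> nat by apply/eqP; rewrite eqn_leq leni -ltnS ltn_ord.
by rewrite subnn subSnn /= compo0l // ssign0.
Qed.

(** * The bracket of the series of the a(p) *)

Lemma sum_bool (F : bool -> G) : \sum_(s : bool) F s = F true + F false.
Proof. exact: big_bool. Qed.

(** The weight p! q!/(p + q - 1)! of [bullet] cancels the Taylor factorials up to 1/n!, where n = p
    + q - 1. *)
Lemma bullet_acomp p q a b xs : valid xs -> (size xs).+1 = (p + q)%N ->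
  bullet ev p q (acomp ev br pE a p) (acomp ev br pE b q) xs =
  ((size xs)`!%:R)^-1 *: compo ev p q (tseries a) (tseries b) xs.
Proof.
case: p => [|p] hxs hs; first by rewrite compo0l ?scaler0 // hs.
rewrite /bullet -hs /=.
rewrite (@eq_compo _ _ _ (fun ys => (p.+1)`!%:R^-1 *: tseries a ys) _
  (fun ys => q`!%:R^-1 *: tseries b ys)) //; last 2 first.
- by move=> ys _; exact: acomp_tseries.
- by move=> ys _; exact: acomp_tseries.
rewrite compoZ //; last exact: symlinop_tseries.
rewrite scalerA; congr (_ *: _).
rewrite mulrAC -[RHS]mul1r; congr (_ * _).
by rewrite -invfM mulfV // mulf_neq0 ?fact_neq0.
Qed.

Lemma sum_bullet s a b xs : homog s b -> valid xs ->
  \sum_(q < (size xs).+2) bullet ev ((size xs).+1 - q) q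
     (acomp ev br pE a ((size xs).+1 - q)) (acomp ev br pE b q) xs =
  ((size xs)`!%:R)^-1 *: tder s (tseries a) (tseries b) xs.
Proof.
move=> hb hxs; rewrite (tder_compo (symlinop_tseries a) (homop_tseries hb) hxs).
rewrite scaler_sumr; apply: eq_bigr => q _; apply: bullet_acomp => //.
by rewrite subnK // -ltnS.
Qed.

Lemma sum_bullet_rev s a b xs : homog s b -> valid xs ->
  \sum_(p < (size xs).+2) bullet ev p ((size xs).+1 - p)
     (acomp ev br pE a p) (acomp ev br pE b ((size xs).+1 - p)) xs =
  ((size xs)`!%:R)^-1 *: tder s (tseries a) (tseries b) xs.
Proof.
move=> hb hxs; rewrite -(sum_bullet a hb hxs) (reindex_inj rev_ord_inj) /=.
by apply: eq_bigr => p _; rewrite subSS subKn // -ltnS.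
Qed.

(** Both sides are [E]-valued and solve the equation for [br a b], so uniqueness applies. *)
Lemma tseries_br s t a b xs : homog s a -> homog t b -> valid xs ->
  tder t (tseries a) (tseries b) xs - ssign (s && t) (tder s (tseries b) (tseries a) xs)
  = tseries (br a b) xs.
Proof.
move=> ha hb hxs; have pE_der u c d ys :
    pE (tder u (tseries c) (tseries d) ys) = tder u (tseries c) (tseries d) ys.
  by rewrite pE_tder; apply: eq1_tder => // zs; exact: pE_tseries.
(* A derivative uses up one degree: with cut-off [N] the commutator is controlled only below
   [N.-1]. *)
pose N := (size xs).+2.
have -> : tseries (br a b) xs = picard N (br a b) N.-1 xs.
  apply: picard_unique => // ys hy hs.
  by split; [exact: pE_tseries | apply: tseries_eq => //; exact: leqW].
apply: (picard_unique (f := fun ys => tder t (tseries a) (tseries b) ys -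
  ssign (s && t) (tder s (tseries b) (tseries a) ys))) => // ys hy hs; split.
  by rewrite pEB pE_ssign !pE_der.
apply: fundamental_bracket ha hb (homop_tseries ha) (homop_tseries hb) _ _ hy _ => //.
- by move=> zs hz hsz; exact: tseries_eq.
- by move=> zs hz hsz; exact: tseries_eq.
Qed.

Lemma tseries_proj a xs : valid xs ->
  tseries a xs = \sum_(s : bool) tseries (proj s a) xs.
Proof.
move=> hxs; rewrite sum_bool /= -[tseries (proj true a) xs]scale1r -tseriesL //.
by rewrite scale1r addrC projD.
Qed.

Lemma acompL k a b p xs : valid xs -> size xs = p ->
  acomp ev br pE (k *: a + b) p xs
  = k *: acomp ev br pE a p xs + acomp ev br pE b p xs.
Proof.
move=> hxs hs; rewrite !acomp_tseries // tseriesL // scalerDr !scalerA.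
by rewrite [k * _]mulrC.
Qed.

(** [tseries] is linear in [a] and preserves parity, so it commutes with taking parity
    components. *)
Lemma opPar_acomp s a p xs : valid xs -> size xs = p ->
  opPar ev s (acomp ev br pE a p) xs = acomp ev br pE (proj s a) p xs.
Proof.
move=> hxs hs; rewrite /opPar !acomp_tseries // projZ tseries_proj // sum_bool.
congr (_ *: _); rewrite -[tseries (proj true a) xs]scale1r projL scale1r.
rewrite !(proj_homog _ (homop_tseries (homog_proj _ a) hxs)).
by case: s; case: (psum xs); rewrite /= ?addr0 ?add0r.
Qed.

Lemma eq_bullet p q A A' B B' xs : valid xs -> (size xs).+1 = (p + q)%N ->
  (forall ys, valid ys -> size ys = p -> A ys = A' ys) ->
  (forall ys, valid ys -> size ys = q -> B ys = B' ys) ->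
  bullet ev p q A B xs = bullet ev p q A' B' xs.
Proof.
by case: p => [|p] hxs hs hA hB //; rewrite /bullet (eq_compo hxs _ hs hA hB).
Qed.

Lemma bullet_acomp_proj p q a b xs : valid xs -> (size xs).+1 = (p + q)%N ->
  bullet ev p q (acomp ev br pE a p) (acomp ev br pE b q) xs =
  \sum_(s : bool) \sum_(t : bool)
    bullet ev p q (acomp ev br pE (proj s a) p) (acomp ev br pE (proj t b) q) xs.
Proof.
case: p => [|p] hxs hs; first by rewrite !sum_bool /= !addr0.
rewrite !sum_bool !bullet_acomp // -!scalerDr; congr (_ *: _).
have hr c : compo ev p.+1 q (tseries c) (tseries b) xs =
  compo ev p.+1 q (tseries c) (tseries (proj true b)) xs
  + compo ev p.+1 q (tseries c) (tseries (proj false b)) xs.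
  rewrite -[X in _ = X + _]scale1r -compoLr //; last exact: symlinop_tseries.
  by apply: eq_compo => // ys hy _; rewrite scale1r tseries_proj // sum_bool.
rewrite -!hr -[X in _ = X + _]scale1r -compoLl.
by apply: eq_compo => // ys hy _; rewrite scale1r tseries_proj // sum_bool.
Qed.

(** Reduces the bilinearly extended sign rule of [dbr] to homogeneous pairs, as [tseries_br]
    requires. *)
Lemma dbr_acomp p q a b xs : valid xs -> (size xs).+1 = (p + q)%N ->
  dbr ev p q (acomp ev br pE a p) (acomp ev br pE b q) xs =
  \sum_(s : bool) \sum_(t : bool)
   (bullet ev p q (acomp ev br pE (proj s a) p) (acomp ev br pE (proj t b) q) xs
    - ssign (s && t)
       (bullet ev q p (acomp ev br pE (proj t b) q) (acomp ev br pE (proj s a) p) xs)).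
Proof.
move=> hxs hs; rewrite /dbr bullet_acomp_proj // -sumrB; apply: eq_bigr => s _.
rewrite -sumrB; apply: eq_bigr => t _; congr (_ - ssign _ _).
by apply: eq_bullet; rewrite // 1?addnC // => ys hy hsy; exact: opPar_acomp.
Qed.

(** With the sum over orders moved inside the sums over parities, the sums of [bullet] become
    directional derivatives and [tseries_br] applies to each pair of components. *)
Lemma sum_dbr a b xs : valid xs ->
  \sum_(p < (size xs).+2) dbr ev p ((size xs).+1 - p) (acomp ev br pE a p)
     (acomp ev br pE b ((size xs).+1 - p)) xs
  = acomp ev br pE (br a b) (size xs) xs.
Proof.
move=> hxs.
under eq_bigr => p _ do rewrite dbr_acomp ?subnKC // -1?ltnS //.
rewrite exchange_big /=; under eq_bigr => s _ do rewrite exchange_big /=.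
transitivity (\sum_(s : bool) \sum_(t : bool)
  ((size xs)`!%:R)^-1 *: tseries (br (proj s a) (proj t b)) xs).
  apply: eq_bigr => s _; apply: eq_bigr => t _; rewrite sumrB.
  rewrite (sum_bullet_rev _ (homog_proj t b) hxs).
  under [X in _ - X]eq_bigr => p _ do rewrite ssignE.
  rewrite -scaler_sumr (sum_bullet _ (homog_proj s a) hxs) -ssignE ssignZ -scalerBr.
  by rewrite (tseries_br (homog_proj s a) (homog_proj t b) hxs).
have D c d : tseries (c + d) xs = tseries c xs + tseries d xs.
  by rewrite -[c in LHS]scale1r tseriesL // scale1r.
rewrite (acomp_tseries _ (erefl (size xs))) !sum_bool -[in RHS](projD a) -[in RHS](projD b).
rewrite brDl !brDr !D !scalerDr.
by rewrite [RHS]addrC; congr (_ + _); rewrite addrC.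
Qed.

Lemma op_symmetric_acomp a p : op_symmetric ev p (acomp ev br pE a p).
Proof.
move=> xs hxs hs i hi; pose x0 : bool * G := (false, 0).
have e : xs = take i xs ++ nth x0 xs i :: nth x0 xs i.+1 :: drop i.+2 xs.
  by rewrite -!drop_nth ?hs ?(ltnW hi) // cat_take_drop.
have hsw : size (swap_at i xs) = p.
  by rewrite -hs {2}e /swap_at !size_cat.
rewrite !acomp_tseries // ssignZ; congr (_ *: _).
have [sym _] := symlinop_tseries a.
have := sym (take i xs) (nth x0 xs i) (nth x0 xs i.+1) (drop i.+2 xs).
by rewrite -e; exact.
Qed.

End TaylorOperators.

Theorem theorem5p4 (K : fieldType) (G : lmodType K)
  (ev : G -> G) (br : G -> G -> G) (pE : G -> G)
  (charK : [pchar K] =i pred0)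
  (hG : is_lie_superalgebra ev br) (hD : is_decomposition ev br pE) :
  (* a(p) lies in S_E cap S_{1-p} *)
  (forall (a : G) (p : nat),
     op_symmetric ev p (acomp ev br pE a p) /\
     (forall xs, valid ev xs -> size xs = p ->
        pE (acomp ev br pE a p xs) = acomp ev br pE a p xs)) /\
  (* linearity of a |-> sum_p a(p) *)
  (forall (k : K) (a b : G) (p : nat) xs, valid ev xs -> size xs = p ->
     acomp ev br pE (k *: a + b) p xs
     = k *: acomp ev br pE a p xs + acomp ev br pE b p xs) /\
  (* [[ sum_p a(p), sum_q b(q) ]] = sum_r [a,b](r), compared order by order *)
  (forall (a b : G) (r : nat) xs, valid ev xs -> size xs = r ->
     \sum_(p < r.+2)
        dbr ev (p : nat) (r.+1 - p) (acomp ev br pE a p)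
            (acomp ev br pE b (r.+1 - p)) xs
     = acomp ev br pE (br a b) r xs).
Proof.
split=> [a p|]; last split=> [k a b p xs hxs hs|a b r xs hxs hs].
- split=> [|xs _ _]; first exact: op_symmetric_acomp.
  exact: (pE_acomp hD).
- exact: acompL.
- by rewrite -hs; apply: sum_dbr.
Qed.
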